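(* Let $(\sigma_j)_{j\in\mathbb{N}}$ be a sequence of positive real numbers such that $\inf_{j\in\mathbb{N}}\sigma_j>0$. For every $d\in\mathbb{N}$ let $\mathbb{G}_d=\otimes_{j=1}^d G_{\sigma_j}$ be the zero-mean random element of $L_2(\mathbb{R}^d,\mu^d)$, where $\mu^d$ is the standard Gaussian measure on $\mathbb{R}^d$, given by a zero-mean random field on $\mathbb{R}^d$ with covariance function $$\mathcal{K}^{\mathbb{G}_d}(t,s)=\prod_{j=1}^d\exp\Bigl\{-\frac{(t_j-s_j)^2}{2\sigma_j^2}\Bigr\},\qquad t,s\in\mathbb{R}^d.$$ The sequence of approximation problems for $\mathbb{G}_d$, $d\in\mathbb{N}$, is quasi-polynomially tractable if and only if $$\sup_{d\in\mathbb{N}}\ \frac{1}{\ln_+ d}\sum_{j=1}^d\frac{1+\ln(1+\sigma_j^2)}{\sigma_j^2}<\infty.$$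
   Context: $\mathbb{N}$ is the set of positive integers. $\ln_+ x=\max\{1,\ln x\}$ for $x>0$. For $\sigma>0$, $G_\sigma(t)$, $t\in\mathbb{R}$, is a zero-mean random process with covariance function (squared exponential kernel) $\mathcal{K}^{G_\sigma}(t,s)=e^{-(t-s)^2/(2\sigma^2)}$, $t,s\in\mathbb{R}$, regarded as a random element of $L_2(\mathbb{R},\mu)$, where $\mu$ is the standard Gaussian distribution on $\mathbb{R}$. Its covariance operator acts by $K^{G_\sigma}f(t)=\int_{\mathbb{R}}e^{-(t-s)^2/(2\sigma^2)}f(s)\frac{1}{\sqrt{2\pi}}e^{-s^2/2}\,ds$, and its eigenvalues are $\lambda^{G_\sigma}_k=(1-\omega_\sigma)\omega_\sigma^{k-1}$, $k\in\mathbb{N}$, where $\omega_\sigma=(1+\sigma^2I_\sigma)^{-1}$ and $I_\sigma=\frac12+\frac12\sqrt{1+4/\sigma^2}$. The covariance operator of $\mathbb{G}_d$ is the integral operator on $L_2(\mathbb{R}^d,\mu^d)=\otimes_{j=1}^d L_2(\mathbb{R},\mu)$ with kernel $\mathcal{K}^{\mathbb{G}_d}$ (integration with respect to $\mu^d$), i.e. $K^{\mathbb{G}_d}=\otimes_{j=1}^d K^{G_{\sigma_j}}$; this is what the notation $\mathbb{G}_d=\otimes_{j=1}^d G_{\sigma_j}$ means. For a zero-mean random element $X_d$ of a separable Hilbert space $H_d$ with $\mathbb{E}\|X_d\|_{H_d}^2<\infty$, let $$e^{X_d}(n)=\inf\Bigl\{\bigl(\mathbb{E}\|X_d-\widetilde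 X\|_{H_d}^2\bigr)^{1/2}:\ \widetilde X=\sum_{m=1}^n l_m(X_d)\psi_m,\ \psi_m\in H_d,\ l_m\in H_d^*\Bigr\},\quad n\in\mathbb{N},$$ where $H_d^*$ is the space of continuous linear functionals on $H_d$, and $e^{X_d}(0)=(\mathbb{E}\|X_d\|_{H_d}^2)^{1/2}$. The average case approximation complexity is $$n^{X_d}(\varepsilon)=\min\{n\in\mathbb{N}:\ e^{X_d}(n)\leqslant\varepsilon\,e^{X_d}(0)\},\qquad \varepsilon\in(0,1).$$ Equivalently, if $(\lambda^{X_d}_k)_{k\in\mathbb{N}}$ is the non-increasing sequence of eigenvalues of the covariance operator of $X_d$ (extended by zeros in the finite-dimensional case) and $\Lambda^{X_d}=\sum_{k}\lambda^{X_d}_k$, then $n^{X_d}(\varepsilon)=\min\{n\in\mathbb{N}:\sum_{k=n+1}^\infty\lambda^{X_d}_k\leqslant\varepsilon^2\Lambda^{X_d}\}$. For a tensor product of $X_{1,1},\dots,X_{1,d}$ these eigenvalues are the products $\prod_{j=1}^d\lambda^{X_{1,j}}_{k_j}$, $k_1,\dots,k_d\in\mathbb{N}$, of the eigenvalues of the marginal covariance operators, arranged in non-increasing order. The sequence of approximation problems for $X_d$, $d\in\mathbb{N}$, is called quasi-polynomially tractable if there are numbers $C>0$ and $s\geqslant 0$ such that $$n^{X_d}(\varepsilon)\leqslant C\exp\bigl\{s(1+\ln\varepsilon^{-1})(1+\ln d)\bigr\}\quad\text{for all } d\in\mathbb{N},\ \varepsilon\in(0,1).$$ *)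

(* Defs.v *)
From HB Require Import structures.
From mathcomp Require Import all_boot all_order all_algebra.
From mathcomp Require Import all_classical all_reals all_analysis.

Set Implicit Arguments.
Unset Strict Implicit.
Unset Printing Implicit Defensive.
Import Order.TTheory GRing.Theory Num.Theory.
Local Open Scope classical_set_scope.
Local Open Scope ring_scope.

(* Square-integrable measurable functions. Functions that agree a.e. are not
   identified, so L2norm is a seminorm; functionals bounded with respect to it
   are exactly those that factor through the Hilbert space of a.e. classes and
   are continuous there. *)
Definition L2 d (E : measurableType d) (R : realType)
  (mu : {measure set E -> \bar R}) := LfunType mu (lee1n 2).

Definition L2norm d (E : measurableType d) (R : realType)
  (mu : {measure set E -> \bar R}) (f : L2 mu) : \bar R :=
  'N[mu]_2%:E[EFin \o f].

Definition continuous_functional d (E : measurableType d) (R : realType)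
  (mu : {measure set E -> \bar R}) (l : {scalar (L2 mu)}) : Prop :=
  exists C : R, forall f : L2 mu, (`|l f|%:E <= C%:E * L2norm f)%E.

(* (E ||Y||^2)^(1/2) for Y : Omega -> L2(mu) *)
Definition mean_square_norm d d' (Omega : measurableType d)
  (E : measurableType d') (R : realType) (P : probability Omega R)
  (mu : {measure set E -> \bar R}) (Y : Omega -> L2 mu) : \bar R :=
  Lnorm P 2%:E (fun w => L2norm (Y w)).

(* For n = 0 the only approximation is 0, so that approx_error P X 0 is
   mean_square_norm P X. *)
Definition approx_error d d' (Omega : measurableType d)
  (E : measurableType d') (R : realType) (P : probability Omega R)
  (mu : {measure set E -> \bar R}) (X : Omega -> L2 mu) (n : nat) : \bar R :=
  ereal_inf [set e | exists (l : 'I_n -> {scalar (L2 mu)}) (psi : 'I_n -> L2 mu),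
    (forall m, continuous_functional (l m)) /\
    e = mean_square_norm P
          (fun w => X w - \sum_(m < n) l m (X w) *: psi m)].

(* The infimum of a nonempty set of naturals is its minimum; it is +oo when no
   n achieves the accuracy. *)
Definition complexity d d' (Omega : measurableType d)
  (E : measurableType d') (R : realType) (P : probability Omega R)
  (mu : {measure set E -> \bar R}) (X : Omega -> L2 mu) (eps : R) : \bar R :=
  ereal_inf [set n%:R%:E | n in [set n : nat | (0 < n)%N /\
    (approx_error P X n <= eps%:E * approx_error P X 0)%E]].

(* compl d eps is the complexity of the d-th problem; only d >= 1 matters. *)
Definition quasi_polynomially_tractable (R : realType)
  (compl : nat -> R -> \bar R) : Prop :=
  exists C s : R, [/\ 0 < C, 0 <= s &
    forall (d : nat) (eps : R), (0 < d)%N -> 0 < eps -> eps < 1 ->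
      (compl d eps <=
       (C * expR (s * (1 + ln eps^-1) * (1 + ln d%:R)))%:E)%E].

Definition ln_plus (R : realType) (x : R) : R := Num.max 1 (ln x).

Definition tcons (T : Type) n (p : T * n.-tuple T) : n.+1.-tuple T :=
  [tuple of p.1 :: p.2].

Lemma measurable_tcons d (T : measurableType d) n :
  measurable_fun setT (@tcons T n).
Proof. exact: measurable_cons. Qed.

HB.instance Definition _ d (T : measurableType d) n :=
  isMeasurableFun.Build _ _ _ _ (@tcons T n) (@measurable_tcons d T n).

Definition Rn (R : realType) (n : nat) := n.-tuple (measurableTypeR R).
HB.instance Definition _ R n := Measurable.on (@Rn R n).

Fixpoint std_gaussian (R : realType) (n : nat) : probability (Rn R n) R :=
  if n is m.+1 then
    distribution (normal_prob 0 1 \x std_gaussian R m)%E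
                 (@tcons (measurableTypeR R) m)
  else \d_([tuple] : Rn R 0).

Definition sqexp_kernel (R : realType) (sigma : nat -> R) (d : nat)
  (t s : Rn R d) : R :=
  \prod_(j < d)
    expR (- ((tnth t j - tnth s j) ^+ 2 / (2 * sigma j ^+ 2))).

(* A random element of L2(R^d, mu^d) given by a jointly measurable zero-mean
   random field with covariance function sqexp_kernel. *)
Definition sqexp_field (R : realType) (sigma : nat -> R) (d : nat)
  dO (Omega : measurableType dO) (P : probability Omega R)
  (X : Omega -> L2 (std_gaussian R d)) : Prop :=
  [/\ measurable_fun [set: Omega * Rn R d] (fun p => X p.1 p.2),
      forall t, ('E_P[(X ^~ t)] = 0)%E &
      forall t s, covariance P (X ^~ t) (X ^~ s) =
                  (sqexp_kernel sigma t s)%:E].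

(* Main.v *)
Require Import Defs.
From HB Require Import structures.
From mathcomp Require Import all_boot all_order all_algebra.
From mathcomp Require Import all_classical all_reals all_analysis.
From mathcomp Require Import measurable_realfun ring lra.

(** The squared exponential kernel of width sigma is diagonal, in L2 of the
    standard Gaussian measure, on the Hermite functions [eigenfun w k], with
    eigenvalues (1 - w) w^k, where w in (0, 1) solves
    sigma^2 w = (1 - w)^2. This is Mehler's formula: completing the square
    turns kernel times eigenfunction times density into 1 - w times a Hermite
    polynomial times the density of a Gaussian of mean w t and standard
    deviation 1 - w, and Stein's identity [normal_mean_stein] evaluates such
    integrals by induction on the degree. Products over the coordinates
    diagonalise the kernel on R^d; the eigenvalues
    lam a = prod_j (1 - w_j) w_j^(a_j) are the probabilities of the values of a
    vector of independent geometric variables, so they add up to 1.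

    The approximation error is compared with these numbers through finite
    orthonormal families Phi of eigenfunctions only; completeness of the whole
    eigenbasis is replaced by the fact that the mean square norm of the field,
    which is 1, is exhausted by the eigenvalues. Fubini's theorem shows that
    the coefficients ip (X w) (Phi i) are uncorrelated with variances lam i
    [coefficient_cov]. Projecting on Phi bounds the squared error by
    1 - sum_i lam i [approx_error_le]. Conversely, a rank n approximation changes
    the vector of coefficients by an element of a fixed space of dimension at
    most n; by Bessel's inequality its squared error is at least
    sum_i lam i (1 - q i), where q is the diagonal of the orthogonal projection
    on that space, so that 0 <= q i <= 1 and sum_i q i <= n
    [approx_error_lower_bound].

    What remains is a question on the product law lam: when do exp(O(ln d))
    points carry most of its mass? If sum_j w_j (1 - ln w_j) = O(ln_+ d), then
    the moment sum_a (lam a)^(1 - delta) with delta = 1 / (4 ln_+ d) is bounded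
    in d, and Markov's inequality for lam^(-delta) shows that the points where
    lam is at least exp(- c (1 + ln (1 / eps)) ln_+ d) suffice
    [few_eigenvalues_suffice]. Conversely, if n points carry half of the mass,
    then sum_a (lam a)^(1 + theta) is at least of order n^(-theta); for
    theta = 1 / ln_+ d this forces sum_j (w_j - w_j^(1 + theta)) = O(1), hence
    sum_j - w_j ln w_j = O(ln_+ d) [entropy_le_of_small_dimension]. Exponents
    within 1 / ln_+ d of 1 are what make the logarithm of w_j appear. Finally
    1 + sigma^2 <= 1 / w <= 2 + sigma^2, so that for sigma bounded away from 0
    the terms w (1 - ln w) are comparable with
    (1 + ln (1 + sigma^2)) / sigma^2. *)

Set Implicit Arguments.
Unset Strict Implicit.
Unset Printing Implicit Defensive.
Import Order.TTheory GRing.Theory Num.Theory.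
Import numFieldNormedType.Exports.
Local Open Scope classical_set_scope.
Local Open Scope ring_scope.

(** * Integrals with known values *)

(** Integrability and the value of the integral are always needed together;
    bundling them makes both follow from the same algebraic steps. *)
Definition integrates_to d (T : measurableType d) (R : realType)
    (mu : {measure set T -> \bar R}) (f : T -> R) (v : R) : Prop :=
  mu.-integrable setT (EFin \o f) /\ (\int[mu]_x (f x)%:E)%E = v%:E.

Section integrates_to_theory.
Context d (T : measurableType d) (R : realType).
Variable mu : {measure set T -> \bar R}.
Implicit Types (f g : T -> R) (a u v : R).

Lemma integrates_to_ext f g v : f =1 g -> integrates_to mu f v ->
  integrates_to mu g v.
Proof. by move=> /funext ->. Qed.

Lemma integrates_to_uniq f u v : integrates_to mu f u -> integrates_to mu f v ->
  u = v.
Proof. by move=> [_ fu] [_ fv]; apply: EFin_inj; rewrite -fu -fv. Qed.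

Lemma integrates_to_measurable f v : integrates_to mu f v ->
  measurable_fun setT f.
Proof. by move=> [/integrableP[/measurable_EFinP]]. Qed.

Lemma integrable_integrates_to f : mu.-integrable setT (EFin \o f) ->
  exists v, integrates_to mu f v.
Proof.
move=> fi; exists (fine (\int[mu]_x (f x)%:E)%E); split => //.
by rewrite fineK//; exact: integrable_fin_num fi.
Qed.

Lemma integrates_to0 : integrates_to mu (fun=> 0) 0.
Proof. by split; [exact: integrable0|exact: integral0]. Qed.

Lemma integrates_toD f g u v : integrates_to mu f u -> integrates_to mu g v ->
  integrates_to mu (fun x => f x + g x) (u + v).
Proof.
move=> [fi fu] [gi gv]; split.
  by apply: (eq_integrable _ ((EFin \o f) \+ (EFin \o g))%E) => //; exact: integrableD.
by rewrite EFinD -fu -gv -integralD_EFin.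
Qed.

Lemma integrates_toZ a f v : integrates_to mu f v ->
  integrates_to mu (fun x => a * f x) (a * v).
Proof.
move=> [fi fv]; split.
  by apply: (eq_integrable _ (fun x => a%:E * (EFin \o f) x)%E) => //; exact: integrableZl.
by rewrite EFinM -fv -integralZl.
Qed.

Lemma integrates_toB f g u v : integrates_to mu f u -> integrates_to mu g v ->
  integrates_to mu (fun x => f x - g x) (u - v).
Proof.
move=> fu gv; rewrite -mulN1r.
apply: integrates_to_ext (integrates_toD fu (integrates_toZ (-1) gv)) => x.
by rewrite mulN1r.
Qed.

Lemma integrates_to_sum (I : Type) (r : seq I) (P : pred I)
    (f : I -> T -> R) (v : I -> R) :
  (forall i, P i -> integrates_to mu (f i) (v i)) ->
  integrates_to mu (fun x => \sum_(i <- r | P i) f i x) (\sum_(i <- r | P i) v i).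
Proof.
move=> fv; elim: r => [|i r IHr].
  by rewrite big_nil; apply: integrates_to_ext integrates_to0 => x; rewrite big_nil.
have [Pi|Pi] := boolP (P i).
  rewrite big_cons Pi.
  apply: integrates_to_ext (integrates_toD (fv i Pi) IHr) => x.
  by rewrite big_cons Pi.
rewrite big_cons (negbTE Pi); apply: integrates_to_ext IHr => x.
by rewrite big_cons (negbTE Pi).
Qed.

Lemma integrates_to_le f g u v : (forall x, f x <= g x) ->
  integrates_to mu f u -> integrates_to mu g v -> u <= v.
Proof.
move=> fg [fi fu] [gi gv]; rewrite -lee_fin -fu -gv.
by apply: le_integral => // x _; rewrite lee_fin.
Qed.

Lemma integrates_to_ge0 f v : (forall x, 0 <= f x) -> integrates_to mu f v ->
  0 <= v.
Proof. by move=> f0 fv; exact: integrates_to_le f0 integrates_to0 fv. Qed.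

Lemma ge0_integrates_to f v : measurable_fun setT f -> (forall x, 0 <= f x) ->
  (\int[mu]_x (f x)%:E)%E = v%:E -> integrates_to mu f v.
Proof.
move=> mf f0 fv; split=> //; apply/integrableP; split.
  exact/measurable_EFinP.
under eq_integral do rewrite /= ger0_norm ?f0//.
by rewrite fv ltry.
Qed.

Lemma integrable_dominated f g : measurable_fun setT f ->
  (forall x, `|f x| <= g x) -> mu.-integrable setT (EFin \o g) ->
  mu.-integrable setT (EFin \o f).
Proof.
move=> mf fg; apply: le_integrable => //; first exact/measurable_EFinP.
move=> x _ /=; rewrite lee_fin (ger0_norm (le_trans _ (fg x)))//.
Qed.

(** The squared error of an arbitrary finite rank approximation need not be a
    measurable function on the sample space. Both integrals are suprema of
    integrals of simple functions, so monotonicity survives. *)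
Lemma ge0_le_integralT (f g : T -> \bar R) : (forall x, 0 <= f x <= g x)%E ->
  (\int[mu]_x f x <= \int[mu]_x g x)%E.
Proof.
move=> fg; have f0 x : (0 <= f x)%E by case/andP: (fg x).
have g0 x : (0 <= g x)%E by case/andP: (fg x) => f0' /(le_trans f0').
rewrite !ge0_integralTE//; apply: ub_ereal_sup => /= _ [h hf <-].
apply: ereal_sup_ubound; exists h => //= x.
by apply: le_trans (hf x) _; case/andP: (fg x).
Qed.

End integrates_to_theory.

Lemma mul_le_sqrD (R : realDomainType) (x y : R) : `|x * y| <= x ^+ 2 + y ^+ 2.
Proof.
rewrite normrM -(real_normK (num_real x)) -(real_normK (num_real y)).
have := sqr_ge0 (`|x| - `|y|); have := normr_ge0 x; have := normr_ge0 y.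
by move: `|x| `|y| => a b *; nra.
Qed.

Section integrates_to_product.
Context d1 d2 (T1 : measurableType d1) (T2 : measurableType d2) (R : realType).
Variables (m1 : probability T1 R) (m2 : probability T2 R).

Lemma integrates_to_prod (f : T1 -> R) (g : T2 -> R) u v :
  integrates_to m1 f u -> integrates_to m2 g v ->
  integrates_to (m1 \x m2)%E (fun p => f p.1 * g p.2) (u * v).
Proof.
move=> fu gv; have mf := integrates_to_measurable fu.
have mg := integrates_to_measurable gv.
have mfg : measurable_fun setT (EFin \o (fun p : T1 * T2 => f p.1 * g p.2)).
  apply/measurable_EFinP; apply: measurable_funM.
    by apply: measurableT_comp => //; exact: measurable_fst.
  by apply: measurableT_comp => //; exact: measurable_snd.
have [[fi fE] [gi gE]] := (fu, gv).
have inner x : (\int[m2]_y (f x * g y)%:E = (f x * v)%:E)%E.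
  by have [_ ->] := integrates_toZ (f x) gv.
have int : (m1 \x m2)%E.-integrable setT (EFin \o (fun p : T1 * T2 => f p.1 * g p.2)).
  apply/integrable12ltyP => //=.
  have [w gw] : exists w, integrates_to m2 (fun y => `|g y|) w.
    by apply: integrable_integrates_to; apply: integrable_abse gi.
  have [z fz] : exists w, integrates_to m1 (fun y => `|f y|) w.
    by apply: integrable_integrates_to; apply: integrable_abse fi.
  rewrite (eq_integral (fun x => (w * `|f x|)%:E)) => [|x _]; last first.
    under eq_integral do rewrite normrM.
    by have [_ ->] := integrates_toZ `|f x| gw; rewrite mulrC.
  by have [_ ->] := integrates_toZ w fz; rewrite ltry.
split => //; rewrite -integral12_prod_meas1//=.
rewrite (eq_integral (fun x => (v * f x)%:E)) => [|x _]; last first.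
  by rewrite /fubini_F/= inner mulrC.
by have [_ ->] := integrates_toZ v fu; rewrite mulrC.
Qed.

(** Fubini's theorem in the form that transports the known integral of B over
    the second space to A; since every section is integrable, A and B are
    defined everywhere and no almost-everywhere argument is left. *)
Lemma integrates_to_swap (F G : T1 -> T2 -> R) A B v :
  measurable_fun setT (fun p => F p.1 p.2) ->
  (forall x y, `|F x y| <= G x y) ->
  (m1 \x m2)%E.-integrable setT (EFin \o (fun p => G p.1 p.2)) ->
  (forall x, integrates_to m2 (F x) (A x)) ->
  (forall y, integrates_to m1 (F ^~ y) (B y)) ->
  integrates_to m2 B v -> integrates_to m1 A v.
Proof.
move=> mF FG Gi FA FB Bv.
have Fi : (m1 \x m2)%E.-integrable setT (EFin \o (fun p => F p.1 p.2)).
  by apply: integrable_dominated Gi => // p.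
have AE : fubini_F m2 (EFin \o (fun p => F p.1 p.2)) = EFin \o A.
  by apply/funext => x; rewrite /fubini_F/=; have [_ ->] := FA x.
have BE : fubini_G m1 (EFin \o (fun p => F p.1 p.2)) = EFin \o B.
  by apply/funext => x; rewrite /fubini_G/=; have [_ ->] := FB x.
split; first by rewrite -AE; exact: integrable_fubini_F.
transitivity (\int[m1]_x fubini_F m2 (EFin \o (fun p => F p.1 p.2)) x)%E.
  by rewrite AE.
rewrite integral12_prod_meas1// -integral21_prod_meas1// BE.
by case: Bv.
Qed.

End integrates_to_product.

Lemma integrates_to_pushforward d1 d2 (T1 : measurableType d1)
    (T2 : measurableType d2) (R : realType) (P : probability T1 R)
    (h : {mfun T1 >-> T2}) (f : T2 -> R) v :
  measurable_fun setT f -> integrates_to P (f \o h) v ->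
  integrates_to (distribution P h) f v.
Proof.
move=> mf [fi fv]; split; first by apply: integrable_pushforward => //; exact/measurable_EFinP.
by rewrite integral_distribution//; exact/measurable_EFinP.
Qed.

(** * Polynomials against a Gaussian density *)

Section gaussian_integrals.
Variable R : realType.
Implicit Types (p q : {poly R}) (m s x : R).
Local Notation leb := (@lebesgue_measure R).

(** A monomial y^n is at most C exp(a y^2), because
    1 + y^2 <= K (1 + a y^2 / (n + 1)) for a suitable K and
    (1 + z / (n + 1))^n <= exp z. *)
Lemma horner_gauss_bound p m a : 0 < a ->
  exists C : R, forall x, `|p.[x]| <= C * expR (a * (x - m) ^+ 2).
Proof.
move=> a0.
have mono n : exists C : R, forall y, `|y ^+ n| <= C * expR (a * y ^+ 2).
  pose K := 1 + n.+1%:R / a; exists (K ^+ n) => y.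
  have K0 : 0 <= K by rewrite addr_ge0// divr_ge0 ?ltW.
  have yb : `|y| <= K * (1 + a * y ^+ 2 / n.+1%:R).
    have -> : K * (1 + a * y ^+ 2 / n.+1%:R) =
        1 + y ^+ 2 + (n.+1%:R / a + a * y ^+ 2 / n.+1%:R).
      have : n.+1%:R != 0 :> R by rewrite pnatr_eq0.
      by rewrite /K; move: n.+1%:R => N N0; field; rewrite N0 gt_eqF.
    have y2 : `|y| <= 1 + y ^+ 2.
      by rewrite -(real_normK (num_real y)); have := sqr_ge0 (`|y| - 1);
        have := normr_ge0 y; nra.
    apply: le_trans y2 _.
    have a0' := ltW a0.
    by rewrite lerDl addr_ge0//; apply: divr_ge0 => //; rewrite mulr_ge0 ?sqr_ge0.
  rewrite normrX; apply: le_trans (_ : (K * (1 + a * y ^+ 2 / n.+1%:R)) ^+ n <= _).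
    by rewrite lerXn2r// nnegrE//; apply: le_trans yb.
  rewrite exprMn ler_wpM2l ?exprn_ge0//.
  have z0 : 0 <= a * y ^+ 2 / n.+1%:R by rewrite divr_ge0// mulr_ge0 ?sqr_ge0 ?ltW.
  apply: (@le_trans _ _ (expR (a * y ^+ 2 / n.+1%:R) ^+ n)).
    rewrite lerXn2r ?nnegrE ?expR_ge0 ?addr_ge0//; exact: expR_ge1Dx.
  rewrite -expRM_natr ler_expR mulrAC ler_pdivrMr ?ltr0n// ler_wpM2l ?ler_nat//.
  by rewrite mulr_ge0 ?sqr_ge0 ?(ltW a0).
have shift : exists C : R, forall y, `|(p \Po ('X + m%:P)).[y]| <= C * expR (a * y ^+ 2).
  move: (p \Po _) => q; have [c hc] := choice mono.
  exists (\sum_(i < size q) `|q`_i| * c i) => y.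
  rewrite horner_coef mulr_suml; apply: le_trans (ler_norm_sum _ _ _) _.
  apply: ler_sum => i _; rewrite normrM -mulrA ler_wpM2l//.
have [C hC] := shift; exists C => x.
by have := hC (x - m); rewrite horner_comp !hornerE subrK.
Qed.

Lemma normal_pdf_expR m s x : 0 < s ->
  normal_pdf m s x = normal_peak s * expR (- (x - m) ^+ 2 / (s ^+ 2 * 2)).
Proof. by move=> s0; rewrite normal_pdfE ?gt_eqF// /normal_fun mulr_natr. Qed.

Lemma integrates_to_normal_pdf m s : integrates_to leb (normal_pdf m s) 1.
Proof. by split; [exact: integrable_normal_pdf|exact: integral_normal_pdf]. Qed.

(** A polynomial is absorbed by doubling the standard deviation; this gives
    both integrability and decay at infinity. *)
Lemma horner_normal_bound p m s : 0 < s -> exists C : R, forall x,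
  `|p.[x] * normal_pdf m s x| <= C * normal_pdf m (s * 2) x.
Proof.
move=> s0; have a0 : 0 < 3 / (8 * s ^+ 2) by rewrite divr_gt0// mulr_gt0// exprn_gt0.
have s20 : 0 < s * 2 by rewrite mulr_gt0.
have P2 : 0 < normal_peak (s * 2) by rewrite normal_peak_gt0 ?gt_eqF.
have [C hC] := horner_gauss_bound p m a0.
exists (C * normal_peak s / normal_peak (s * 2)) => x.
rewrite normrM (ger0_norm (normal_pdf_ge0 _ _ _)) !normal_pdf_expR//.
rewrite mulrA [X in _ <= X](_ : _ =
  C * normal_peak s * expR (- (x - m) ^+ 2 / ((s * 2) ^+ 2 * 2))); last first.
  by field; rewrite gt_eqF.
have -> : - (x - m) ^+ 2 / ((s * 2) ^+ 2 * 2) = 3 / (8 * s ^+ 2) * (x - m) ^+ 2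
    + - (x - m) ^+ 2 / (s ^+ 2 * 2).
  by field; rewrite gt_eqF.
rewrite expRD mulrA ler_wpM2r ?expR_ge0//.
rewrite mulrAC ler_wpM2r ?normal_peak_ge0//.
Qed.

Lemma continuous_horner_normal p m s : 0 < s ->
  continuous (fun x => p.[x] * normal_pdf m s x).
Proof.
move=> s0 x; apply: continuousM; first exact: continuous_horner.
by apply: continuous_normal_pdf; rewrite gt_eqF.
Qed.

Lemma horner_normal_integrable p m s : 0 < s ->
  leb.-integrable setT (EFin \o (fun x => p.[x] * normal_pdf m s x)).
Proof.
move=> s0; have [C hC] := horner_normal_bound p m s0.
apply: (@integrable_dominated _ _ R leb _ (fun x => C * normal_pdf m (s * 2) x)) => //.
  apply: continuous_measurable_fun; exact: continuous_horner_normal.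
by have [] := integrates_toZ C (integrates_to_normal_pdf m (s * 2)).
Qed.

Lemma horner_normal_cvg0 p m s c (u : R^nat) : 0 < s -> 0 <= c ->
  (forall n, n%:R <= `|u n - m| + c) ->
  (p.[u n] * normal_pdf m s (u n)) @[n --> \oo] --> (0 : R).
Proof.
move=> s0 c0 un.
have [C hC] := horner_normal_bound ((1 + ('X - m%:P) ^+ 2) * p) m s0.
pose M := (c + 2) * (`|C| * normal_peak (s * 2)).
have hM n : `|p.[u n] * normal_pdf m s (u n)| <= M * (n.+1%:R)^-1.
  have := le_trans (hC (u n)) (ler_wpM2r (normal_pdf_ge0 _ _ _) (ler_norm C)).
  have s2 : s * 2 != 0 by rewrite gt_eqF// mulr_gt0.
  move=> /le_trans /(_ (ler_wpM2l (normr_ge0 C) (normal_pdf_ub m (u n) s2))).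
  rewrite hornerM -mulrA normrM !hornerE => h.
  rewrite ler_pdivlMr ?ltr0n// mulrC.
  apply: le_trans (_ : (c + 2) * (`|1 + (u n - m) ^+ 2| * `|p.[u n] * normal_pdf m s (u n)|) <= _).
    rewrite mulrA ler_wpM2r// ger0_norm; last by rewrite addr_ge0 ?sqr_ge0.
    rewrite -natr1 -(real_normK (num_real (u n - m))).
    move: (un n); move: `|u n - m| => a na.
    have a2 : 0 <= (a - 1) ^+ 2 by exact: sqr_ge0.
    have ca : 0 <= c * a ^+ 2 by rewrite mulr_ge0 ?sqr_ge0.
    by nra.
  by rewrite /M ler_wpM2l// addr_ge0.
apply/norm_cvg0P; apply: (@squeeze_cvgr _ _ _ _ (fun=> 0) (fun n => M * n.+1%:R^-1)).
- by apply: nearW => n; rewrite normr_ge0 hM.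
- exact: cvg_cst.
- rewrite -[X in _ --> X](mulr0 M); apply: cvgMr => //; exact: cvg_harmonic.
Qed.

(** The fundamental theorem of calculus on [-n, n], with n tending to
    infinity by dominated convergence. *)
Lemma integral_derivative_eq0 (F f : R -> R) :
  (forall x, is_derive x (1 : R) F (f x)) -> continuous f ->
  leb.-integrable setT (EFin \o f) ->
  F n%:R @[n --> \oo] --> (0 : R) -> F (- n%:R) @[n --> \oo] --> (0 : R) ->
  integrates_to leb f 0.
Proof.
move=> dF cf fi Fp Fn; split => //.
pose D n := `[- n.+1%:R, n.+1%:R]%classic : set R.
pose g n := ((EFin \o f) \_ (D n) : R -> \bar R).
have mf := measurable_int leb fi.
have mD n : measurable (D n) by exact: measurable_itv.
have [] := @dominated_convergence _ _ _ leb setT measurableT g (EFin \o f)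
  (abse \o (EFin \o f)).
- move=> n; apply/(measurable_restrictT _ _).1; first exact: mD.
  exact: (measurable_funS measurableT (@subsetT _ _) mf).
- exact: mf.
- apply: aeW => x _; apply: cvg_near_cst.
  near=> n; rewrite /g patchE ifT// inE /D/= in_itv/= -ler_norml.
  apply: (@le_trans _ _ n%:R); last by rewrite ler_nat.
  by near: n; exact: nbhs_infty_ger.
- by apply: integrable_abse.
- apply: aeW => x n _; rewrite /g patchE; case: ifPn => // _ /=.
  by rewrite normr0 lee_fin.
move=> _ _; set L := (\int[leb]_x _)%E => gL.
have gE n : (\int[leb]_x (g n x) = (F n.+1%:R - F (- n.+1%:R))%:E)%E.
  rewrite /g -integral_mkcond EFinB; apply: continuous_FTC2.
  - by rewrite -subr_gt0 opprK addr_gt0.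
  - exact: continuous_subspaceT.
  - have cF x : {for x, continuous F}.
      by apply: differentiable_continuous; apply/derivable1_diffP; have [] := dF x.
    split; first by move=> x _; have [] := dF x.
    + by apply: cvg_at_right_filter; exact: cF.
    + by apply: cvg_at_left_filter; exact: cF.
  - by move=> x _; rewrite derive1E; have [_ ->] := dF x.
have lim0 : ((F n.+1%:R - F (- n.+1%:R))%:E @[n --> \oo] --> (0 : R)%:E)%E.
  apply: cvg_EFin; first exact: nearW.
  rewrite -[X in _ --> X](subr0 0); apply: cvgB.
    by move: Fp; rewrite -cvg_shiftS.
  by move: Fn; rewrite -cvg_shiftS.
move: gL; rewrite [X in X @ _](_ : _ = (fun n => (F n.+1%:R - F (- n.+1%:R))%:E)); last first.
  by apply/funext => n; exact: gE.
by move=> gL; exact: (cvg_unique _ gL lim0).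
Unshelve. all: by end_near.
Qed.

End gaussian_integrals.

Section normal_mean.
Variable R : realType.
Implicit Types (p q : {poly R}) (m s x : R).
Local Notation leb := (@lebesgue_measure R).

Definition normal_mean m s p : R := (\int[leb]_x (p.[x] * normal_pdf m s x)).

Lemma normal_meanP m s p : 0 < s ->
  integrates_to leb (fun x => p.[x] * normal_pdf m s x) (normal_mean m s p).
Proof.
move=> s0; have i := horner_normal_integrable p m s0; split => //.
by rewrite /normal_mean /Rintegral fineK//; exact: integrable_fin_num i.
Qed.

Lemma normal_mean_eq m s p v : 0 < s ->
  integrates_to leb (fun x => p.[x] * normal_pdf m s x) v ->
  normal_mean m s p = v.
Proof. by move=> s0; exact: integrates_to_uniq (normal_meanP _ _ s0). Qed.

Lemma normal_mean1 m s : 0 < s -> normal_mean m s 1 = 1.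
Proof.
move=> s0; apply: normal_mean_eq => //.
apply: integrates_to_ext (integrates_to_normal_pdf m s) => x.
by rewrite hornerC mul1r.
Qed.

Lemma normal_meanD m s p q : 0 < s ->
  normal_mean m s (p + q) = normal_mean m s p + normal_mean m s q.
Proof.
move=> s0; apply: normal_mean_eq => //.
apply: integrates_to_ext (integrates_toD (normal_meanP m p s0) (normal_meanP m q s0)) => x.
by rewrite hornerD mulrDl.
Qed.

Lemma normal_meanZ m s a p : 0 < s ->
  normal_mean m s (a *: p) = a * normal_mean m s p.
Proof.
move=> s0; apply: normal_mean_eq => //.
apply: integrates_to_ext (integrates_toZ a (normal_meanP m p s0)) => x.
by rewrite hornerZ mulrA.
Qed.

Lemma normal_meanB m s p q : 0 < s ->
  normal_mean m s (p - q) = normal_mean m s p - normal_mean m s q.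
Proof. by move=> s0; rewrite -scaleN1r normal_meanD// normal_meanZ// mulN1r. Qed.

Lemma normal_mean0 m s : 0 < s -> normal_mean m s 0 = 0.
Proof. by move=> s0; rewrite -(scale0r 1) normal_meanZ// mul0r. Qed.

Lemma is_derive_horner_normal p m s x : 0 < s ->
  is_derive x (1 : R) (fun y => p.[y] * normal_pdf m s y)
    ((p^`() - (s ^+ 2)^-1 *: (('X - m%:P) * p)).[x] * normal_pdf m s x).
Proof.
move=> s0.
have -> : (fun y => p.[y] * normal_pdf m s y) =
    (fun y => p.[y] * (normal_peak s *
       expR ((- (s ^+ 2 * 2)^-1 *: ('X - m%:P) ^+ 2).[y]))).
  apply/funext => y; rewrite normal_pdf_expR// hornerZ horner_exp hornerXsubC.
  congr (_ * (_ * expR _)).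
  by rewrite mulrC mulNr mulrN.
apply: is_derive_eq.
rewrite normal_pdf_expR// derivZ deriv_exp derivXsubC.
rewrite !(hornerD, hornerN, hornerZ, hornerM, horner_exp, hornerXsubC, hornerMn, hornerC).
have -> : - (x - m) ^+ 2 / (s ^+ 2 * 2) = - (s ^+ 2 * 2)^-1 * (x - m) ^+ 2.
  by rewrite mulrC mulNr mulrN.
rewrite /GRing.scale/= hornerX !mul1r expr2.
by move: (expR _) => e; field; rewrite gt_eqF.
Qed.

(** Stein's identity: the derivative of p times the density is
    (p' - (x - m) p / s^2) times the density, and it integrates to 0 over the
    line. *)
Lemma normal_mean_stein m s p : 0 < s ->
  normal_mean m s (('X - m%:P) * p) = s ^+ 2 * normal_mean m s p^`().
Proof.
move=> s0; set r := p^`() - (s ^+ 2)^-1 *: (('X - m%:P) * p).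
suff : normal_mean m s r = 0.
  rewrite /r normal_meanB// normal_meanZ// => /eqP; rewrite subr_eq0 => /eqP ->.
  by rewrite mulrA mulfV ?mul1r// expf_neq0// gt_eqF.
apply: normal_mean_eq => //.
apply: (@integral_derivative_eq0 _ (fun y => p.[y] * normal_pdf m s y)).
- by move=> x; exact: is_derive_horner_normal.
- exact: continuous_horner_normal.
- exact: horner_normal_integrable.
- apply: (@horner_normal_cvg0 _ _ _ _ `|m|) => // n.
  by have := ler_norm (n%:R - m); have := ler_norm m; lra.
- apply: (@horner_normal_cvg0 _ _ _ _ `|m|) => // n.
  rewrite -normrN; have := ler_norm (- (- n%:R - m)).
  by have := ler_norm (- m); rewrite [X in _ <= X -> _]normrN; lra.
Qed.

End normal_mean.

(** * Hermite functions and Mehler's formula *)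

Section hermite.
Variable R : realType.
Implicit Types (v w m s x t : R) (k l : nat).
Local Notation leb := (@lebesgue_measure R).

(** The monic orthogonal polynomials of the centred Gaussian law of variance v. *)
Fixpoint hermite v k : {poly R} :=
  if k is k'.+1 then 'X * hermite v k' - v *: (hermite v k')^`() else 1.

Lemma deriv_hermite v k : (hermite v k.+1)^`() = k.+1%:R *: hermite v k.
Proof.
elim: k => [|k IHk].
  by rewrite /= mulr1 derivB derivX derivZ derivC linear0 scaler0 subr0 scale1r.
have -> : hermite v k.+2 = 'X * hermite v k.+1 - v *: (k.+1%:R *: hermite v k).
  by rewrite -IHk.
rewrite derivB derivM derivX mul1r !derivZ IHk.
have -> : k.+2%:R *: hermite v k.+1 = hermite v k.+1 + k.+1%:R *: hermite v k.+1.
  by rewrite -natr1 scalerDl scale1r addrC.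
rewrite -addrA; congr (_ + _).
by rewrite /= -scalerAr scalerBr !scalerA (mulrC v).
Qed.

(** By Stein's identity the operator p |-> x p - v p' that raises the degree is
    v times the adjoint of d/dx. *)
Lemma normal_mean_hermiteS s k q : 0 < s ->
  normal_mean 0 s (hermite (s ^+ 2) k.+1 * q) =
  s ^+ 2 * normal_mean 0 s (hermite (s ^+ 2) k * q^`()).
Proof.
move=> s0; set v := s ^+ 2; rewrite [hermite v k.+1]/=.
have -> : ('X * hermite v k - v *: (hermite v k)^`()) * q =
    ('X - 0%:P) * (hermite v k * q) - v *: ((hermite v k)^`() * q).
  by rewrite subr0 mulrBl -mulrA -scalerAl.
rewrite normal_meanB// normal_meanZ// normal_mean_stein// derivM normal_meanD//.
by rewrite -/v mulrDr addrAC subrr add0r.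
Qed.

Lemma hermite_orthogonal s k l : 0 < s ->
  normal_mean 0 s (hermite (s ^+ 2) k * hermite (s ^+ 2) l) =
  if k == l then k`!%:R * (s ^+ 2) ^+ k else 0.
Proof.
move=> s0; elim: k l => [|k IHk] [|l].
- by rewrite mulr1 normal_mean1// mul1r.
- rewrite mulrC normal_mean_hermiteS// derivC mulr0.
  by rewrite normal_mean0// mulr0.
- rewrite normal_mean_hermiteS// derivC mulr0.
  by rewrite normal_mean0// mulr0.
- rewrite normal_mean_hermiteS// deriv_hermite -scalerAr normal_meanZ// IHk.
  rewrite eqSS; case: eqVneq => [<-|]; last by rewrite !mulr0.
  by rewrite factS natrM [_ ^+ k.+1]exprS; ring.
Qed.

(** Mehler's formula. If S has mean w t and standard deviation 1 - w, and
    v = (1 - w) / (1 + w), then (1 - w)^2 = (1 - w^2) v: for a centred Gaussian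
    t of variance v, S has the same law as t and correlation w with it. The
    conditional mean of the k-th Hermite polynomial is then w^k times its value
    at t; Stein's identity and the recurrence of these polynomials give the
    induction. *)
Lemma mehler w t k : 0 < w < 1 ->
  normal_mean (w * t) (1 - w) (hermite ((1 - w) / (1 + w)) k) =
  w ^+ k * (hermite ((1 - w) / (1 + w)) k).[t].
Proof.
move=> /andP[w0 w1]; set v := (1 - w) / (1 + w).
have s0 : 0 < 1 - w by rewrite subr_gt0.
have w1' : 1 + w != 0 by rewrite gt_eqF// addr_gt0.
suff [] : normal_mean (w * t) (1 - w) (hermite v k) = w ^+ k * (hermite v k).[t] /\
  normal_mean (w * t) (1 - w) (hermite v k)^`() = w ^+ k.-1 * (hermite v k)^`().[t] by [].
elim: k => [|k [IHk IHk']].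
  by rewrite /= derivC normal_mean1// normal_mean0// hornerC horner0 mulr0 mulr1.
split; last by rewrite deriv_hermite normal_meanZ// IHk hornerZ; ring.
rewrite [hermite v k.+1]/= normal_meanB// normal_meanZ//.
have -> : 'X * hermite v k = ('X - (w * t)%:P) * hermite v k + (w * t) *: hermite v k.
  by rewrite mulrBl mul_polyC subrK.
rewrite normal_meanD// normal_meanZ// normal_mean_stein// IHk.
rewrite !(hornerD, hornerN, hornerZ, hornerM, hornerX, hornerC) IHk'.
case: k {IHk IHk'} => [|k]; first by rewrite /= derivC horner0 hornerC; ring.
move: (hermite v k.+1).[t] (hermite v k.+1)^`().[t] => a b.
by rewrite !exprS /= /v; move: (w ^+ k) => c; field.
Qed.

End hermite.

Section eigenfunctions.
Variable R : realType.
Implicit Types (w s x t : R) (k l : nat).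
Local Notation leb := (@lebesgue_measure R).

(** The square of the first eigenfunction, times the standard Gaussian density,
    is the centred Gaussian density of this variance. *)
Definition eigen_var w : R := (1 - w) / (1 + w).

(** The Hermite function whose Gaussian factor turns the standard Gaussian
    weight into the weight of variance [eigen_var w]; the square root
    normalises it in L2. *)
Definition eigenfun w k t : R :=
  Num.sqrt ((Num.sqrt (eigen_var w) * k`!%:R * eigen_var w ^+ k)^-1) *
  expR (- (w / (1 - w) / 2 * t ^+ 2)) * (hermite (eigen_var w) k).[t].

Lemma normal_peakE s : 0 < s -> normal_peak s = s^-1 * normal_peak 1 :> R.
Proof.
move=> s0; rewrite /normal_peak -mulrnAr sqrtrM ?sqr_ge0// sqrtr_sqr gtr0_norm//.
by rewrite invfM expr1n -mulrnAr mul1r.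
Qed.

Lemma eigen_var_gt0 w : 0 < w < 1 -> 0 < eigen_var w.
Proof. by move=> /andP[w0 w1]; rewrite divr_gt0 ?subr_gt0// addr_gt0. Qed.

Lemma eigenfun_orthonormal w k l : 0 < w < 1 ->
  integrates_to leb (fun t => eigenfun w k t * eigenfun w l t * normal_pdf 0 1 t)
    (k == l)%:R.
Proof.
move=> w01; have v0 := eigen_var_gt0 w01; set v := eigen_var w in v0 *.
have sv0 : 0 < Num.sqrt v by rewrite sqrtr_gt0.
pose c k := Num.sqrt ((Num.sqrt v * k`!%:R * v ^+ k)^-1).
have -> : (k == l)%:R = c k * c l * Num.sqrt v *
    normal_mean 0 (Num.sqrt v) (hermite v k * hermite v l) :> R.
  rewrite -[in hermite v](sqr_sqrtr (ltW v0)) hermite_orthogonal// sqr_sqrtr ?ltW//.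
  case: eqVneq => [<-|]; last by rewrite mulr0.
  rewrite -expr2 sqr_sqrtr; last first.
    by rewrite invr_ge0 !mulr_ge0 ?ltW// exprn_gt0.
  rewrite -mulrA [X in _ * X]mulrA mulVf// gt_eqF// !mulr_gt0// ?exprn_gt0//.
apply: integrates_to_ext (integrates_toZ _ (normal_meanP _ _ sv0)) => t.
rewrite !normal_pdf_expR// (normal_peakE sv0) sqr_sqrtr ?ltW// hornerM.
rewrite /eigenfun -/v -/(c k) -/(c l) subr0.
have -> : - t ^+ 2 / (v * 2) = - (w / (1 - w) / 2 * t ^+ 2) + - (w / (1 - w) / 2 * t ^+ 2) +
    - t ^+ 2 / (1 ^+ 2 * 2).
  rewrite /v /eigen_var; move/andP: w01 => [w0 w1]; field.
  by rewrite !gt_eqF ?subr_gt0 ?addr_gt0.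
rewrite !expRD; move: (expR _) (expR _) => a b; field.
by rewrite gt_eqF.
Qed.

(** Completing the square: kernel, Gaussian factor and standard density combine
    into 1 - w times the density with mean w t and standard deviation 1 - w,
    to which Mehler's formula applies. *)
Lemma eigenfun_kernel w sigma k t : 0 < w < 1 -> 0 < sigma ->
  sigma ^+ 2 * w = (1 - w) ^+ 2 ->
  integrates_to leb (fun s => expR (- ((t - s) ^+ 2 / (2 * sigma ^+ 2))) *
      eigenfun w k s * normal_pdf 0 1 s)
    ((1 - w) * w ^+ k * eigenfun w k t).
Proof.
move=> w01 s0 ws; have /andP[w0 w1] := w01.
have w1' : 0 < 1 - w by rewrite subr_gt0.
set c := Num.sqrt ((Num.sqrt (eigen_var w) * k`!%:R * eigen_var w ^+ k)^-1).
pose g t := expR (- (w / (1 - w) / 2 * t ^+ 2)).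
have -> : (1 - w) * w ^+ k * eigenfun w k t = (1 - w) * c * g t *
    normal_mean (w * t) (1 - w) (hermite (eigen_var w) k).
  by rewrite mehler// /eigenfun -/c -/(g t); ring.
apply: integrates_to_ext (integrates_toZ _ (normal_meanP _ _ w1')) => s.
rewrite !normal_pdf_expR// (normal_peakE w1') /eigenfun -/c -/(g s).
have -> : sigma ^+ 2 = (1 - w) ^+ 2 / w by rewrite -ws mulfK// gt_eqF.
have : g t * expR (- (s - w * t) ^+ 2 / ((1 - w) ^+ 2 * 2)) =
    expR (- ((t - s) ^+ 2 / (2 * ((1 - w) ^+ 2 / w)))) * g s * expR (- (s - 0) ^+ 2 / (1 ^+ 2 * 2)).
  by rewrite /g -!expRD; congr expR; field; rewrite !gt_eqF.
move: (expR _) (expR (- ((t - s) ^+ 2 / _))) (expR _) => a b d E.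
transitivity ((c * (hermite (eigen_var w) k).[s] * normal_peak 1) * (g t * d)).
  by field; rewrite gt_eqF.
by rewrite E; ring.
Qed.

Lemma measurable_eigenfun w k : measurable_fun setT (eigenfun w k).
Proof.
apply: measurable_funM.
  apply: measurable_funM => //; apply: measurableT_comp => //.
  apply: measurableT_comp => //; apply: measurable_funM => //.
by apply: continuous_measurable_fun; exact: continuous_horner.
Qed.

End eigenfunctions.

(** * Products over the coordinates *)

Section normal_prob_density.
Variables (R : realType) (m s : R).
Local Notation leb := (@lebesgue_measure R).

(** The density is the Radon-Nikodym derivative up to a null set. *)
Lemma ge0_integral_normal_prob (f : R -> \bar R) : measurable_fun setT f ->
  (forall x, 0 <= f x)%E ->
  (\int[normal_prob m s]_x f x = \int[leb]_x (f x * (normal_pdf m s x)%:E))%E.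
Proof.
move=> mf f0; have dom := normal_prob_dominates m s.
rewrite -(Radon_Nikodym_SigmaFinite.change_of_variables dom)//.
have RNi := Radon_Nikodym_SigmaFinite.f_integrable dom.
apply: ae_eq_integral => //.
- by apply: emeasurable_funM => //; exact: measurable_int RNi.
- by apply: emeasurable_funM => //; apply/measurable_EFinP; exact: measurable_normal_pdf.
- apply: ae_eqe_mul2l; apply: integral_ae_eq => //.
  + by apply/measurable_EFinP; exact: measurable_normal_pdf.
  + by move=> E _ mE; rewrite -(Radon_Nikodym_SigmaFinite.f_integral dom).
Qed.

Lemma integrates_to_normal_prob (f : R -> R) v : measurable_fun setT f ->
  integrates_to leb (fun x => f x * normal_pdf m s x) v ->
  integrates_to (normal_prob m s) f v.
Proof.
move=> mf [fi fv].
have mE : measurable_fun setT (EFin \o f) by exact/measurable_EFinP.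
split.
  apply/integrableP; split => //.
  rewrite ge0_integral_normal_prob//; last exact: measurableT_comp.
  case/integrableP : fi => _; apply: le_lt_trans; rewrite le_eqVlt; apply/orP; left.
  apply/eqP; apply: eq_integral => x _ /=.
  by rewrite normrM [X in _ = (_ * X)%:E]ger0_norm ?normal_pdf_ge0// EFinM.
rewrite -fv integralE [RHS]integralE; congr (_ - _)%E.
  rewrite ge0_integral_normal_prob//; last exact: measurable_funepos.
  apply: eq_integral => x _; rewrite !funeposE /= -!EFin_max -EFinM; congr EFin.
  by rewrite maxr_pMl ?normal_pdf_ge0// mul0r.
rewrite ge0_integral_normal_prob//; last exact: measurable_funeneg.
apply: eq_integral => x _; rewrite !funenegE /= -!EFin_max -EFinM; congr EFin.
by rewrite maxr_pMl ?normal_pdf_ge0// mul0r mulNr.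
Qed.

End normal_prob_density.

Section std_gaussian_product.
Variable R : realType.

Lemma measurable_tnth_prod d (f : 'I_d -> R -> R) :
  (forall j, measurable_fun setT (f j)) ->
  measurable_fun setT (fun t : Rn R d => \prod_(j < d) f j (tnth t j)).
Proof.
move=> mf; apply: measurable_prod => j _.
exact: (measurableT_comp (mf j) (@measurable_tnth _ (measurableTypeR R) d j)).
Qed.

Lemma integrates_to_std_gaussian d (f : 'I_d -> R -> R) (v : 'I_d -> R) :
  (forall j, integrates_to (normal_prob 0 1) (f j) (v j)) ->
  integrates_to (std_gaussian R d) (fun t => \prod_(j < d) f j (tnth t j))
    (\prod_(j < d) v j).
Proof.
elim: d f v => [|d IHd] f v fv.
  rewrite big_ord0; apply: (@integrates_to_ext _ _ _ _ (fun=> 1)).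
    by move=> t; rewrite big_ord0.
  by apply: ge0_integrates_to => //; rewrite integral_cst//= diracT mule1.
have mf j : measurable_fun setT (f j) := integrates_to_measurable (fv j).
apply: integrates_to_pushforward; first exact: measurable_tnth_prod.
have h := integrates_to_prod (fv ord0) (IHd _ _ (fun j => fv (lift ord0 j))).
rewrite big_ord_recl; apply: integrates_to_ext h => p.
rewrite /= big_ord_recl /=; congr (_ * _).
by apply: eq_bigr => j _; rewrite tnthS.
Qed.

End std_gaussian_product.

(** * Pairings and orthonormal families in L2 *)

Section L2_facts.
Context d (E : measurableType d) (R : realType) (mu : probability E R).
Implicit Types f g : L2 mu.

Lemma L2_mul_integrable f g : mu.-integrable setT (EFin \o (fun t => f t * g t)).
Proof. by apply/Lfun1_integrable; apply: Lfun2_mul_Lfun1; exact: LfunP. Qed.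

Definition ip f g : R := \int[mu]_t (f t * g t).

Lemma ipP f g : integrates_to mu (fun t => f t * g t) (ip f g).
Proof.
have i := L2_mul_integrable f g; split => //.
by rewrite /ip /Rintegral fineK//; exact: integrable_fin_num i.
Qed.

Lemma L2norm_sqr f : (L2norm f `^ 2 = (ip f f)%:E)%E.
Proof.
rewrite /L2norm powR_Lnorm//.
have [_ <-] := ipP f f; apply: eq_integral => t _ /=.
by rewrite powR_mulrn// real_normK ?num_real// expr2.
Qed.

Lemma ip_ge0 f : 0 <= ip f f.
Proof. by apply: integrates_to_ge0 (ipP f f) => t; rewrite -expr2 sqr_ge0. Qed.

Lemma L2normE f : L2norm f = (Num.sqrt (ip f f))%:E.
Proof.
rewrite -[LHS]poweRe1 ?Lnorm_ge0// -[X in (_ `^ X)%E](@mulfV R 2)//.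
by rewrite poweRrM L2norm_sqr poweR_EFin powR12_sqrt// ip_ge0.
Qed.

Lemma L2D f g t : (f + g) t = f t + g t.
Proof. by []. Qed.

Lemma L2B f g t : (f - g) t = f t - g t.
Proof. by []. Qed.

Lemma L2Z a f t : (a *: f) t = a * f t.
Proof. by []. Qed.

Lemma L2_sum n (F : 'I_n -> L2 mu) t : (\sum_(i < n) F i) t = \sum_(i < n) F i t.
Proof.
elim: n F => [|n IHn] F; first by rewrite !big_ord0.
rewrite !big_ord_recr -IHn; exact: L2D.
Qed.

Lemma ip_is_linear g : linear_for *%R (ip ^~ g).
Proof.
move=> a f1 f2; apply: integrates_to_uniq (ipP _ _) _.
apply: integrates_to_ext (integrates_toD (integrates_toZ a (ipP f1 g)) (ipP f2 g)) => t.
by rewrite L2D L2Z mulrDl mulrA.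
Qed.

(** A named version of the pairing with g, to carry its linear structure. *)
Definition ip_functional g (f : L2 mu) := ip f g.

HB.instance Definition _ g := GRing.isLinear.Build R (L2 mu) R *%R (ip_functional g)
  (ip_is_linear g).

Lemma mean_square_normE d' (Omega : measurableType d') (P : probability Omega R)
    (Y : Omega -> L2 mu) :
  mean_square_norm P Y = ((\int[P]_w (ip (Y w) (Y w))%:E) `^ 2^-1)%E.
Proof.
rewrite /mean_square_norm unlock; congr (_ `^ _)%E; apply: eq_integral => w _.
by rewrite gee0_abs ?Lnorm_ge0// L2norm_sqr.
Qed.

Section orthonormal.
Variables (n : nat) (Phi : 'I_n -> L2 mu).
Hypothesis Phi_orth : forall i j,
  integrates_to mu (fun t => Phi i t * Phi j t) (i == j)%:R.

Lemma orthonormal_distance f (c : 'I_n -> R) :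
  ip (f - \sum_(i < n) c i *: Phi i) (f - \sum_(i < n) c i *: Phi i) =
  ip f f - 2 * \sum_(i < n) c i * ip f (Phi i) + \sum_(i < n) c i ^+ 2.
Proof.
apply: integrates_to_uniq (ipP _ _) _.
have h1 := integrates_to_sum (index_enum 'I_n)
  (fun i (_ : true) => integrates_toZ (c i) (ipP f (Phi i))).
have h2 := integrates_to_sum (index_enum 'I_n)
  (fun i (_ : true) => integrates_to_sum (index_enum 'I_n)
    (fun j (_ : true) => integrates_toZ (c i * c j) (Phi_orth i j))).
have -> : \sum_(i < n) c i ^+ 2 = \sum_(i < n) \sum_(j < n) c i * c j * (i == j)%:R.
  apply: eq_bigr => i _; rewrite (bigD1 i)//= eqxx mulr1 big1 ?addr0// => j ji.
  by rewrite eq_sym (negbTE ji) mulr0.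
apply: integrates_to_ext (integrates_toD (integrates_toB (ipP f f) (integrates_toZ 2 h1)) h2) => t.
rewrite !L2B !L2_sum.
under [X in _ = (_ - X) * _]eq_bigr do rewrite L2Z.
under [X in _ = _ * (_ - X)]eq_bigr do rewrite L2Z.
have -> : \sum_i c i * (f t * Phi i t) = f t * \sum_i c i * Phi i t.
  by rewrite mulr_sumr; apply: eq_bigr => i _; ring.
have -> : \sum_i \sum_j c i * c j * (Phi i t * Phi j t) =
    (\sum_i c i * Phi i t) * (\sum_i c i * Phi i t).
  rewrite mulr_suml; apply: eq_bigr => i _; rewrite mulr_sumr.
  by apply: eq_bigr => j _; ring.
by move: (\sum_i _) => x; ring.
Qed.

Lemma orthonormal_projection f :
  ip (f - \sum_(i < n) ip f (Phi i) *: Phi i) (f - \sum_(i < n) ip f (Phi i) *: Phi i)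
  = ip f f - \sum_(i < n) ip f (Phi i) ^+ 2.
Proof.
rewrite orthonormal_distance.
under [X in _ - 2 * X]eq_bigr do rewrite -expr2.
by move: (\sum_i _) => x; ring.
Qed.

Lemma bessel f : \sum_(i < n) ip f (Phi i) ^+ 2 <= ip f f.
Proof. by rewrite -subr_ge0 -orthonormal_projection ip_ge0. Qed.

Lemma bessel1 f i : ip f (Phi i) ^+ 2 <= ip f f.
Proof.
apply: le_trans (bessel f); rewrite (bigD1 i)//= lerDl sumr_ge0// => j _.
exact: sqr_ge0.
Qed.

Lemma orthonormal_functional i : continuous_functional (ip_functional (Phi i)).
Proof.
exists 1 => f; rewrite mul1e L2normE lee_fin -sqrtr_sqr ler_sqrt ?ip_ge0//.
exact: bessel1.
Qed.

End orthonormal.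
End L2_facts.

(** * Orthogonal projections on row spaces *)

Section orthogonal_projection.
Variables (R : realFieldType) (n N : nat).

Lemma sqnorm_ge0 m (x : 'rV[R]_m) : 0 <= (x *m x^T) 0 0.
Proof. by rewrite mxE sumr_ge0// => i _; rewrite mxE -expr2 sqr_ge0. Qed.

Lemma sqnorm_eq0 m (x : 'rV[R]_m) : (x *m x^T) 0 0 = 0 -> x = 0.
Proof.
rewrite mxE => h; apply/rowP => i; apply/eqP; rewrite [X in _ == X]mxE -sqrf_eq0.
have /psumr_eq0P/(_ h) /(_ i isT) : forall j, true -> 0 <= x 0 j * x^T j 0.
  by move=> j _; rewrite mxE -expr2 sqr_ge0.
by rewrite mxE -expr2 => ->.
Qed.

(** A full-rank B has an invertible Gram matrix G = B B^T, and B^T G^-1 B is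
    the orthogonal projection onto its row space; its trace is the rank. *)
Lemma orthogonal_projection_exists (A : 'M[R]_(n, N)) :
  exists Q : 'M[R]_N, [/\ Q^T = Q, Q *m Q = Q, A *m Q = A & \tr Q <= n%:R].
Proof.
have Bfree := row_base_free A; have AB : (A <= row_base A)%MS by rewrite eq_row_base.
move: (row_base A) Bfree AB => B Bfree AB; pose G := B *m B^T.
have Gu : G \in unitmx.
  rewrite -row_free_unit -kermx_eq0; apply/rowV0P => v /sub_kermxP vG.
  have vB : v *m B = 0.
    by apply: sqnorm_eq0; rewrite trmx_mul mulmxA -(mulmxA v) -/G vG mul0mx mxE.
  by apply: (row_free_inj Bfree); rewrite vB mul0mx.
have GT : G^T = G by rewrite /G trmx_mul trmxK.
exists (B^T *m invmx G *m B); split.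
- by rewrite !trmx_mul trmxK trmx_inv GT mulmxA.
- rewrite !mulmxA -[_ *m B *m B^T]mulmxA -/G -[B^T *m invmx G *m G]mulmxA.
  by rewrite mulVmx// mulmx1.
- have /submxP[C AE] := AB; by rewrite {1}AE !mulmxA
  -[C *m B *m B^T]mulmxA -/G -[C *m G *m _]mulmxA mulmxV// mulmx1 -AE.
- by rewrite mxtrace_mulC mulmxA -/G mulmxV// mxtrace1 ler_nat rank_leq_row.
Qed.

(** Q i i is the squared norm of the i-th row of Q, which includes (Q i i)^2. *)
Lemma projection_diag_itv (Q : 'M[R]_N) i : Q^T = Q -> Q *m Q = Q ->
  0 <= Q i i <= 1.
Proof.
move=> QT QQ; have QE : Q i i = \sum_j Q i j ^+ 2.
  rewrite -{1}QQ mxE; apply: eq_bigr => j _.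
  by rewrite -{2}QT mxE expr2.
have Q0 : 0 <= Q i i by rewrite QE sumr_ge0// => j _; exact: sqr_ge0.
rewrite Q0; have : Q i i ^+ 2 <= Q i i.
  by rewrite {2}QE (bigD1 i)//= lerDl sumr_ge0// => j _; exact: sqr_ge0.
by nra.
Qed.

(** The residual 1 - Q kills c, so u and u - c have the same image, and it does
    not increase the norm of u - c. *)
Lemma projection_residual_le (Q : 'M[R]_N) (u c : 'rV[R]_N) :
  Q^T = Q -> Q *m Q = Q -> c *m Q = c ->
  0 <= (u *m (1%:M - Q) *m u^T) 0 0 <= ((u - c) *m (u - c)^T) 0 0.
Proof.
move=> QT QQ cQ; set S := 1%:M - Q.
have ST : S^T = S by rewrite /S linearB/= trmx1 QT.
have SS : S *m S = S.
  by rewrite /S mulmxBl mul1mx mulmxBr mulmx1 QQ subrr subr0.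
have cS : c *m S = 0 by rewrite /S mulmxBr mulmx1 cQ subrr.
have Sc : S *m c^T = 0 by apply: trmx_inj; rewrite trmx_mul trmxK ST cS trmx0.
apply/andP; split.
  have -> : u *m S *m u^T = (u *m S) *m (u *m S)^T.
    by rewrite trmx_mul ST mulmxA -[u *m S *m S]mulmxA SS.
  exact: sqnorm_ge0.
have -> : u *m S *m u^T = (u - c) *m S *m (u - c)^T.
  have -> : (u - c)^T = u^T - c^T by rewrite linearB.
  by rewrite mulmxBl cS subr0 (mulmxBr (u *m S)) -[u *m S *m c^T]mulmxA Sc mulmx0 subr0.
set v := u - c; rewrite /S mulmxBr mulmx1 mulmxBl [X in X <= _]mxE gerDl mxE oppr_le0.
have -> : v *m Q *m v^T = (v *m Q) *m (v *m Q)^T.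
  by rewrite trmx_mul QT mulmxA -[v *m Q *m Q]mulmxA QQ.
exact: sqnorm_ge0.
Qed.

End orthogonal_projection.

(** * Finite rank approximation of a random field *)

Section field_approximation.
Context dE (E : measurableType dE) (R : realType) (mu : probability E R).
Context dO (Omega : measurableType dO) (P : probability Omega R).
Variables (X : Omega -> L2 mu) (K : E -> E -> R).
Hypothesis mX : measurable_fun [set: Omega * E] (fun p => X p.1 p.2).
Hypothesis meanX : forall t, integrates_to P (X ^~ t) 0.
Hypothesis covX : forall t s, integrates_to P (fun w => X w t * X w s) (K t s).
Hypothesis K1 : forall t, K t t = 1.

Let integrates_to1 d (T : measurableType d) (Q : probability T R) :
  integrates_to Q (fun=> 1) 1.
Proof.
by apply: ge0_integrates_to => //; rewrite integral_cst//= probability_setT mule1.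
Qed.

Let measurable_X t : measurable_fun setT (X ^~ t).
Proof. exact: integrates_to_measurable (meanX t). Qed.

Let sqrX_integrable :
  (P \x mu)%E.-integrable setT (EFin \o (fun p => X p.1 p.2 * X p.1 p.2)).
Proof.
apply/integrable21ltyP => /=.
  by apply/measurable_EFinP; exact: measurable_funM.
rewrite (eq_integral (fun=> 1%E)) => [|t _]; last first.
  have [_] := covX t t; rewrite K1 => <-; apply: eq_integral => w _.
  by rewrite ger0_norm// -expr2 sqr_ge0.
by rewrite integral_cst//= probability_setT mule1 ltry.
Qed.

(** The kernel is 1 on the diagonal and mu has mass 1. *)
Lemma field_sqnorm_mean : integrates_to P (fun w => ip (X w) (X w)) 1.
Proof.
apply: (@integrates_to_swap _ _ _ _ _ P mu (fun w t => X w t * X w t)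
  (fun w t => X w t * X w t) _ (fun=> 1)).
- exact: measurable_funM.
- by move=> w t; rewrite ger0_norm// -expr2 sqr_ge0.
- exact: sqrX_integrable.
- by move=> w; exact: ipP.
- by move=> t; have := covX t t; rewrite K1.
- exact: integrates_to1.
Qed.

(* Each product integrated below is bounded by X^2 plus the square of a product
   of a function on Omega and a function on E. *)
Let dominating (f : Omega -> R) (g : E -> R) u v :
  integrates_to P (fun w => f w ^+ 2) u -> integrates_to mu (fun t => g t ^+ 2) v ->
  (P \x mu)%E.-integrable setT
    (EFin \o (fun p => X p.1 p.2 * X p.1 p.2 + f p.1 ^+ 2 * g p.2 ^+ 2)).
Proof.
move=> fu gv; have [fg _] := integrates_to_prod fu gv.
have [x Xx] := integrable_integrates_to sqrX_integrable.
have [z fgz] := integrable_integrates_to fg.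
by have [] := integrates_toD Xx fgz.
Qed.

Let domination (x a b : R) : `|x * (a * b)| <= x * x + a ^+ 2 * b ^+ 2.
Proof. by rewrite -exprMn -expr2 mul_le_sqrD. Qed.

Variables (n : nat) (Phi : 'I_n -> L2 mu) (lam : 'I_n -> R).
Hypothesis Phi_orth : forall i j,
  integrates_to mu (fun t => Phi i t * Phi j t) (i == j)%:R.
Hypothesis Phi_eigen : forall i t,
  integrates_to mu (fun s => K t s * Phi i s) (lam i * Phi i t).

Let Phi_sqr i : integrates_to mu (fun t => Phi i t ^+ 2) 1.
Proof. by have := Phi_orth i i; rewrite eqxx. Qed.

Let measurable_Phi i : measurable_fun setT (fun p : Omega * E => Phi i p.2).
Proof. by apply: measurableT_comp => //; exact: measurable_snd. Qed.

Let coefficient_mean i : integrates_to P (fun w => ip (X w) (Phi i)) 0.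
Proof.
apply: (@integrates_to_swap _ _ _ _ _ P mu (fun w t => X w t * Phi i t)
  (fun w t => X w t * X w t + 1 ^+ 2 * Phi i t ^+ 2) _ (fun=> 0)).
- exact: measurable_funM.
- by move=> w t; rewrite -[Phi i t in leLHS]mul1r domination.
- apply: (@dominating (fun=> 1) _ 1 1) => //.
  by apply: integrates_to_ext (integrates_to1 P) => w; rewrite expr1n.
- by move=> w; exact: ipP.
- move=> t; rewrite -(mulr0 (Phi i t)).
  by apply: integrates_to_ext (integrates_toZ (Phi i t) (meanX t)) => w; rewrite mulrC.
- exact: integrates_to0.
Qed.

(* Integrating out one copy of Phi i at a time: first the field against its
   value at s, then the resulting lam i * Phi i against Phi j. *)
Let coefficient_field i s :
  integrates_to P (fun w => ip (X w) (Phi i) * X w s) (lam i * Phi i s).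
Proof.
apply: (@integrates_to_swap _ _ _ _ _ P mu (fun w t => X w t * (X w s * Phi i t))
  (fun w t => X w t * X w t + X w s ^+ 2 * Phi i t ^+ 2) _ (fun t => K s t * Phi i t)).
- apply: measurable_funM => //; apply: measurable_funM => //.
  by apply: (measurableT_comp (measurable_X s)); exact: measurable_fst.
- by move=> w t; exact: domination.
- exact: (@dominating (X ^~ s) _ (K s s) 1 (covX s s)).
- move=> w; rewrite mulrC.
  by apply: integrates_to_ext (integrates_toZ (X w s) (ipP (X w) (Phi i))) => t; ring.
- move=> t; rewrite mulrC.
  by apply: integrates_to_ext (integrates_toZ (Phi i t) (covX s t)) => w; ring.
- exact: Phi_eigen.
Qed.

(** The eigenvalue equation, read on the field: its coefficients on eigenfunctions
    are uncorrelated, with the eigenvalues as variances. *)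
Lemma coefficient_cov i j :
  integrates_to P (fun w => ip (X w) (Phi i) * ip (X w) (Phi j)) (lam i * (i == j)%:R).
Proof.
have mZ := integrates_to_measurable (coefficient_mean i).
have [u Zu] : exists u, integrates_to P (fun w => ip (X w) (Phi i) ^+ 2) u.
  apply: integrable_integrates_to.
  apply: (@integrable_dominated _ _ _ _ _ (fun w => ip (X w) (X w))).
  - exact: measurable_funX.
  - by move=> w; rewrite ger0_norm ?sqr_ge0//; exact: bessel1.
  - by case: field_sqnorm_mean.
apply: (@integrates_to_swap _ _ _ _ _ P mu
  (fun w s => X w s * (ip (X w) (Phi i) * Phi j s))
  (fun w s => X w s * X w s + ip (X w) (Phi i) ^+ 2 * Phi j s ^+ 2) _
  (fun s => lam i * (Phi i s * Phi j s))).
- apply: measurable_funM => //; apply: measurable_funM => //.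
  by apply: (measurableT_comp mZ); exact: measurable_fst.
- by move=> w t; exact: domination.
- exact: (@dominating (fun w => ip (X w) (Phi i)) _ u 1 Zu).
- move=> w.
  by apply: integrates_to_ext (integrates_toZ (ip (X w) (Phi i)) (ipP (X w) (Phi j))) => t; ring.
- move=> s; have -> : lam i * (Phi i s * Phi j s) = Phi j s * (lam i * Phi i s) by ring.
  by apply: integrates_to_ext (integrates_toZ (Phi j s) (coefficient_field i s)) => w; ring.
- exact: integrates_toZ.
Qed.

Lemma approx_error0 : approx_error P X 0 = 1%E.
Proof.
have E1 : mean_square_norm P X = 1%E.
  by rewrite mean_square_normE; have [_ ->] := field_sqnorm_mean; rewrite poweR1r.
have E2 (l : 'I_0 -> {scalar (L2 mu)}) (psi : 'I_0 -> L2 mu) :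
    mean_square_norm P (fun w => X w - \sum_(m < 0) l m (X w) *: psi m) = 1%E.
  by rewrite -E1; congr mean_square_norm; apply/funext => w; rewrite big_ord0 subr0.
rewrite /approx_error [X in ereal_inf X](_ : _ = [set 1%E]) ?ereal_inf1//.
apply/seteqP; split => [_ [l [psi [_ ->]]]|_ ->] /=; first exact: E2.
have noidx T : 'I_0 -> T by case.
by exists (noidx _), (noidx _); split; [case|rewrite E2].
Qed.

Lemma approx_error_le : (approx_error P X n <= (Num.sqrt (1 - \sum_(i < n) lam i))%:E)%E.
Proof.
apply: ereal_inf_lbound; exists (fun i => ip_functional (Phi i)), Phi; split.
  by move=> i; exact: orthonormal_functional Phi_orth i.
rewrite mean_square_normE.
under eq_integral do rewrite (orthonormal_projection Phi_orth).
have h : integrates_to P (fun w => ip (X w) (X w) - \sum_(i < n) ip (X w) (Phi i) ^+ 2)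
    (1 - \sum_(i < n) lam i).
  apply: integrates_toB field_sqnorm_mean _; apply: integrates_to_sum => i _.
  by have := coefficient_cov i i; rewrite eqxx mulr1.
have [_ ->] := h; rewrite poweR_EFin powR12_sqrt//.
by apply: integrates_to_ge0 h => w; rewrite subr_ge0; exact: bessel.
Qed.

(** In the coordinates ip _ (Phi i) every value of a rank m approximation lies
    in the row space of the matrix A of coordinates of the psi k. With Q the
    orthogonal projection on that space, Bessel's inequality bounds the squared
    error below by the quadratic form of 1 - Q at the coordinates of X w, whose
    mean is sum_i lam i (1 - Q i i). *)
Lemma approx_error_lower_bound m (e : R) : 0 <= e -> (approx_error P X m < e%:E)%E ->
  exists q : 'I_n -> R, [/\ forall i, 0 <= q i <= 1, \sum_(i < n) q i <= m%:R &
    \sum_(i < n) lam i * (1 - q i) <= e ^+ 2].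
Proof.
move=> e0 /ereal_inf_lt[_ /= [l [psi [_ ->]]]].
set Y := fun w => X w - _; rewrite mean_square_normE => lt_e.
pose A : 'M[R]_(m, n) := \matrix_(k, i) ip (psi k) (Phi i).
have [Q [QT QQ AQ trQ]] := orthogonal_projection_exists A.
exists (fun i => Q i i); split=> //; first by move=> i; exact: projection_diag_itv.
pose S := 1%:M - Q.
pose g w := \sum_i \sum_j S i j * (ip (X w) (Phi i) * ip (X w) (Phi j)).
have gE w : 0 <= g w <= ip (Y w) (Y w).
  pose u : 'rV[R]_n := \row_i ip (X w) (Phi i).
  pose c : 'rV[R]_n := (\row_k l k (X w)) *m A.
  have cQ : c *m Q = c by rewrite /c -mulmxA AQ.
  have -> : g w = (u *m S *m u^T) 0 0.
    rewrite mxE /g exchange_big/=; apply: eq_bigr => j _.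
    rewrite !mxE mulr_suml; apply: eq_bigr => i _; rewrite !mxE; ring.
  have /andP[-> h] := projection_residual_le u QT QQ cQ.
  apply: le_trans h _; apply: le_trans (bessel Phi_orth (Y w)).
  rewrite mxE le_eqVlt; apply/orP; left; apply/eqP; apply: eq_bigr => i _.
  rewrite [(u - c)^T i 0]mxE -expr2; congr (_ ^+ 2).
  apply: integrates_to_uniq _ (ipP (Y w) (Phi i)).
  have h1 := integrates_to_sum (index_enum 'I_m)
    (fun k (_ : true) => integrates_toZ (l k (X w)) (ipP (psi k) (Phi i))).
  rewrite !mxE; under eq_bigr do rewrite !mxE.
  apply: integrates_to_ext (integrates_toB (ipP (X w) (Phi i)) h1) => t.
  rewrite /Y L2B L2_sum mulrBl; congr (_ - _); rewrite mulr_suml.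
  by apply: eq_bigr => k _; rewrite mulrA.
have gint : integrates_to P g (\sum_i lam i * (1 - Q i i)).
  have := integrates_to_sum (index_enum 'I_n) (fun i (_ : true) =>
    integrates_to_sum (index_enum 'I_n) (fun j (_ : true) =>
      integrates_toZ (S i j) (coefficient_cov i j))).
  congr (integrates_to _ _ _); apply: eq_bigr => i _.
  rewrite (bigD1 i)//= big1 ?addr0 => [|j ji].
    by rewrite eqxx !mxE eqxx mulr1 mulrC.
  by rewrite eq_sym (negbTE ji) !mulr0.
set L := \sum_i _ in gint *.
have L0 : 0 <= L by apply: integrates_to_ge0 gint => w; case/andP: (gE w).
have LI : (L%:E <= \int[P]_w (ip (Y w) (Y w))%:E)%E.
  by have [_ <-] := gint; apply: ge0_le_integralT => w; rewrite !lee_fin.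
have : (L%:E `^ 2^-1 < e%:E)%E.
  apply: le_lt_trans lt_e; apply: gt0_ler_poweR => //.
  - by rewrite in_itv/= lee_fin L0 leey.
  - by rewrite in_itv/= leey (le_trans _ LI)// lee_fin.
rewrite poweR_EFin powR12_sqrt// lte_fin => Le.
by rewrite -(sqr_sqrtr L0) lerXn2r ?nnegrE ?sqrtr_ge0// ltW.
Qed.

End field_approximation.

(** * The squared exponential field *)

Section L2_of.
Context d (E : measurableType d) (R : realType) (mu : probability E R).
Variables (f : E -> R) (v : R).
Hypothesis mf : measurable_fun setT f.
Hypothesis fv : integrates_to mu (fun t => f t * f t) v.

Lemma integrable_sqr_Lfun : f \in Lfun mu 2%:E.
Proof.
rewrite inE; apply/andP; split; rewrite inE//=.
apply: (@lty_poweRy _ _ 2) => //; rewrite powR_Lnorm//.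
rewrite (eq_integral (fun t => (f t * f t)%:E)) => [|t _ /=].
  by have [_ ->] := fv; rewrite ltry.
by rewrite powR_mulrn// real_normK ?num_real// expr2.
Qed.

Definition L2_of : L2 mu := Lfun_Sub (lee1n 2) integrable_sqr_Lfun.

End L2_of.

Section sqexp_field_hypotheses.
Context (R : realType) (sigma : nat -> R) (d : nat).
Context dO (Omega : measurableType dO) (P : probability Omega R).
Variable X : Omega -> L2 (std_gaussian R d).
Hypothesis X_field : sqexp_field sigma P X.

Lemma sqexp_kernel_diag (t : Rn R d) : sqexp_kernel sigma t t = 1 :> R.
Proof.
by rewrite /sqexp_kernel big1// => j _; rewrite subrr expr0n/= mul0r oppr0 expR0.
Qed.

Let measurable_X t : measurable_fun setT (X ^~ t).
Proof. by case: X_field => mX _ _; exact: measurable_fun_pair1 mX. Qed.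

Let covE t s : (\int[P]_w (X w t * X w s)%:E)%E = (sqexp_kernel sigma t s)%:E.
Proof.
case: X_field => _ meanX covX; rewrite -covX unlock !meanX unlock.
apply: eq_integral => w _ /=; congr EFin.
by transitivity ((X w t - 0) * (X w s - 0)) => //; rewrite !subr0.
Qed.

Let sqr_integrable t : P.-integrable setT (EFin \o (fun w => X w t ^+ 2)).
Proof.
suff [] : integrates_to P (fun w => X w t ^+ 2) (sqexp_kernel sigma t t) by [].
apply: ge0_integrates_to.
- exact: measurable_funX.
- by move=> w; exact: sqr_ge0.
- exact: covE.
Qed.

(** On the diagonal the covariance is the integral of a nonnegative function, so
    its finiteness yields square integrability of the field at each point. *)
Lemma sqexp_field_cov t s :
  integrates_to P (fun w => X w t * X w s) (sqexp_kernel sigma t s).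
Proof.
split; last exact: covE.
apply: (@integrable_dominated _ _ _ _ _ (fun w => X w t ^+ 2 + X w s ^+ 2)).
- exact: measurable_funM.
- by move=> w; exact: mul_le_sqrD.
- have [u hu] := integrable_integrates_to (sqr_integrable t).
  have [v hv] := integrable_integrates_to (sqr_integrable s).
  by have [] := integrates_toD hu hv.
Qed.

Lemma sqexp_field_mean t : integrates_to P (X ^~ t) 0.
Proof.
case: X_field => _ meanX _; split; last by have := meanX t; rewrite unlock.
have i1 : integrates_to P (fun=> 1 : R) 1.
  by apply: ge0_integrates_to => //; rewrite integral_cst//= probability_setT mule1.
apply: (@integrable_dominated _ _ _ _ _ (fun w => X w t ^+ 2 + 1)) => //.
- by move=> w; have := mul_le_sqrD (X w t) 1; rewrite mulr1 expr1n.
- have [u hu] := integrable_integrates_to (sqr_integrable t).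
  by have [] := integrates_toD hu i1.
Qed.

End sqexp_field_hypotheses.

Section tensor_eigenfunctions.
Variables (R : realType) (sigma w : nat -> R).
Hypothesis sigma_gt0 : forall j, 0 < sigma j.
Hypothesis w01 : forall j, 0 < w j < 1.
Hypothesis sigmaw : forall j, sigma j ^+ 2 * w j = (1 - w j) ^+ 2.
Variables d m : nat.
Implicit Types a b : {ffun 'I_d -> 'I_m}.

Definition tensor_eigenfun a (t : Rn R d) : R :=
  \prod_(j < d) eigenfun (w j) (a j) (tnth t j).

Definition tensor_eigenval a : R := \prod_(j < d) ((1 - w j) * w j ^+ a j).

Lemma tensor_eigenfun_orthonormal a b :
  integrates_to (std_gaussian R d)
    (fun t => tensor_eigenfun a t * tensor_eigenfun b t) (a == b)%:R.
Proof.
have -> : (a == b)%:R = \prod_(j < d) (a j == b j)%:R :> R.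
  have [->|/eqP ab] := eqVneq a b; first by rewrite big1// => j _; rewrite eqxx.
  have [j] : exists j, a j != b j.
    by apply/existsP; rewrite -negb_forall; apply/negP => /forallP h;
       apply: ab; apply/ffunP => j; apply/eqP.
  by move=> /negbTE abj; rewrite (bigD1 j)//= abj mul0r.
apply: (@integrates_to_ext _ _ _ _ (fun t : Rn R d => \prod_(j < d)
    (eigenfun (w j) (a j) (tnth t j) * eigenfun (w j) (b j) (tnth t j)))).
  by move=> t; rewrite big_split.
apply: (@integrates_to_std_gaussian _ _ 
  (fun j x => eigenfun (w j) (a j) x * eigenfun (w j) (b j) x)) => j.
apply: integrates_to_normal_prob; last exact: eigenfun_orthonormal.
by apply: measurable_funM; exact: measurable_eigenfun.
Qed.

Lemma tensor_eigenfun_kernel a t :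
  integrates_to (std_gaussian R d)
    (fun s => sqexp_kernel sigma t s * tensor_eigenfun a s)
    (tensor_eigenval a * tensor_eigenfun a t).
Proof.
rewrite /tensor_eigenval /tensor_eigenfun -big_split/=.
pose f (j : 'I_d) x := expR (- ((tnth t j - x) ^+ 2 / (2 * sigma j ^+ 2))) *
   eigenfun (w j) (a j) x.
apply: (@integrates_to_ext _ _ _ _ (fun s : Rn R d => \prod_(j < d) f j (tnth s j))).
  by move=> s; rewrite big_split.
apply: integrates_to_std_gaussian => j.
apply: integrates_to_normal_prob; last exact: eigenfun_kernel.
apply: measurable_funM; last exact: measurable_eigenfun.
apply: measurableT_comp => //; apply: measurableT_comp => //.
by apply: measurable_funM => //; apply: measurable_funX; exact: measurable_funB.
Qed.

Lemma measurable_tensor_eigenfun a : measurable_fun setT (tensor_eigenfun a).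
Proof.
apply: (@measurable_tnth_prod _ _ (fun j => eigenfun (w j) (a j))) => j.
exact: measurable_eigenfun.
Qed.

Definition tensor_eigenvec a : L2 (std_gaussian R d) :=
  L2_of (@measurable_tensor_eigenfun a) (tensor_eigenfun_orthonormal a a).

Context dO (Omega : measurableType dO) (P : probability Omega R).
Variable X : Omega -> L2 (std_gaussian R d).
Hypothesis X_field : sqexp_field sigma P X.

Lemma sqexp_approx_error_le (A : {set {ffun 'I_d -> 'I_m}}) :
  (approx_error P X #|A| <=
   (Num.sqrt (1 - \sum_(a in A) tensor_eigenval a))%:E)%E.
Proof.
have mX : measurable_fun setT (fun p => X p.1 p.2) by case: X_field.
have := @approx_error_le _ _ _ _ _ _ _ X (@sqexp_kernel R sigma d) mX
  (sqexp_field_mean X_field) (sqexp_field_cov X_field) (@sqexp_kernel_diag R sigma d)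
  #|A| (fun i => tensor_eigenvec (enum_val i)) (fun i => tensor_eigenval (enum_val i)).
rewrite -(big_enum_val tensor_eigenval); apply => [i j|i t]; last exact: tensor_eigenfun_kernel.
have := tensor_eigenfun_orthonormal (enum_val i) (enum_val j).
by rewrite (inj_eq enum_val_inj).
Qed.

Lemma sqexp_approx_error_lower_bound n (e : R) : 0 <= e ->
  (approx_error P X n < e%:E)%E ->
  exists q : {ffun 'I_d -> 'I_m} -> R,
    [/\ forall a, 0 <= q a <= 1, \sum_a q a <= n%:R &
        \sum_a tensor_eigenval a * (1 - q a) <= e ^+ 2].
Proof.
move=> e0 err.
have mX : measurable_fun setT (fun p => X p.1 p.2) by case: X_field.
have [] := @approx_error_lower_bound _ _ _ _ _ _ _ X (@sqexp_kernel R sigma d) mX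
  (sqexp_field_mean X_field) (sqexp_field_cov X_field) (@sqexp_kernel_diag R sigma d)
  _ (fun i : 'I_#|{ffun 'I_d -> 'I_m}| => tensor_eigenvec (enum_val i))
  (fun i => tensor_eigenval (enum_val i)) _ _ _ _ e0 err.
- move=> i j; have := tensor_eigenfun_orthonormal (enum_val i) (enum_val j).
  by rewrite (inj_eq enum_val_inj).
- by move=> i t; exact: tensor_eigenfun_kernel.
move=> q [q01 qn qe]; exists (fun a => q (enum_rank a)); split=> //.
- by rewrite (reindex _ (onW_bij _ (enum_val_bij _)))/=; under eq_bigr do rewrite enum_valK.
- by rewrite (reindex _ (onW_bij _ (enum_val_bij _)))/=; under eq_bigr do rewrite enum_valK.
Qed.

End tensor_eigenfunctions.

(** * Elementary inequalities *)

Section elementary_inequalities.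
Variable R : realType.
Implicit Types (w u x y p delta L D : R).

Lemma prod_1B_ge (n : nat) (a : 'I_n -> R) : (forall i, 0 <= a i <= 1) ->
  1 - \sum_(i < n) a i <= \prod_(i < n) (1 - a i).
Proof.
elim: n a => [|n IHn] a a01; first by rewrite !big_ord0 subr0.
rewrite !big_ord_recr /=; have := IHn _ (fun i => a01 (widen_ord (leqnSn n) i)).
have /andP[] := a01 ord_max; move: (a ord_max) => b b0 b1.
have : 0 <= \sum_(i < n) a (widen_ord (leqnSn n) i).
  by apply: sumr_ge0 => i _; case/andP: (a01 (widen_ord (leqnSn n) i)).
move: (\sum_(i < n) _) (\prod_(i < n) _) => s t; nra.
Qed.

Lemma geometric_sum_le u m : 0 <= u < 1 -> \sum_(k < m) u ^+ k <= (1 - u)^-1.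
Proof.
move=> /andP[u0 u1]; have u1' : 0 < 1 - u by rewrite subr_gt0.
rewrite -[leRHS]mul1r ler_pdivlMr// mulrC -opprB mulNr -subrX1 opprB.
by rewrite gerBl exprn_ge0.
Qed.

Lemma powR_prod (I : Type) (r : seq I) (F : I -> R) p : (forall i, 0 <= F i) ->
  (\prod_(i <- r) F i) `^ p = \prod_(i <- r) (F i `^ p).
Proof.
move=> F0; elim: r => [|i r IHr]; first by rewrite !big_nil powR1.
by rewrite !big_cons powRM ?IHr// prodr_ge0.
Qed.

Lemma powR_expn_comm w k p : 0 <= w -> (w ^+ k) `^ p = (w `^ p) ^+ k.
Proof.
move=> w0; elim: k => [|k IHk]; first by rewrite !expr0 powR1.
by rewrite !exprS powRM ?exprn_ge0// IHk.
Qed.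

Lemma expR_le_affine y : 0 <= y <= 2^-1 -> expR y <= 1 + 2 * y.
Proof.
move=> /andP[y0 y1]; have := expR_ge1Dx (- y).
have y1' : 0 < 1 - y by lra.
rewrite expRN => h; have : expR y <= (1 - y)^-1.
  by rewrite -[expR y]invrK lef_pV2 ?posrE// invr_gt0 expR_gt0.
move=> /le_trans; apply; rewrite -[leLHS]mul1r ler_pdivrMr//; nra.
Qed.

Lemma powR_expR_ln w p : 0 < w -> w `^ p = expR (p * ln w).
Proof. by move=> w0; rewrite /powR gt_eqF. Qed.

(** With L = - ln w: if delta L <= 1 / 2 then w^(-delta) - 1 <= 2 delta L;
    otherwise w is so small that w^(1 - delta) <= w^(1 / 2) is below
    exp(- 1 / (4 delta)), which will be at most 1 / d. *)
Lemma powR_gap_le w delta : 0 < w < 1 -> 0 < delta <= 4^-1 ->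
  w `^ (1 - delta) - w <= 2 * delta * (w * - ln w) + expR (- (4 * delta)^-1).
Proof.
move=> /andP[w0 w1] /andP[d0 d1]; set L := - ln w.
have L0 : 0 < L by rewrite oppr_gt0 ln_lt0// w0.
have E0 := expR_ge0 (- (4 * delta)^-1).
have [yle|ygt] := leP (delta * L) 2^-1.
  have -> : w `^ (1 - delta) = w * expR (delta * L).
    by rewrite powR_expR_ln// mulrBl mul1r expRD lnK ?posrE// /L mulrN.
  have dL : 0 <= delta * L by rewrite mulr_ge0 ?ltW.
  have := @expR_le_affine (delta * L); rewrite yle dL => /(_ isT).
  move=> /(ler_wpM2l (ltW w0)); move: (expR (delta * L)) E0 => a.
  by move: (expR _) => c b0 aL; lra.
have wL : 0 <= 2 * delta * (w * L) by rewrite !mulr_ge0 ?ltW.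
suff h : w `^ (1 - delta) <= expR (- (4 * delta)^-1).
  by lra.
rewrite powR_expR_ln// ler_expR -[ln w]opprK -/L mulrN lerN2.
have : (4 * delta)^-1 <= L / 2.
  rewrite invfM; apply: (@le_trans _ _ (4^-1 * (2 * L))); last by lra.
  rewrite ler_wpM2l ?invr_ge0//; rewrite -[leLHS]mul1r ler_pdivrMr//; nra.
by nra.
Qed.

(** The left-hand side is the sum over k of the powers 1 - delta of the
    geometric probabilities (1 - w) w^k. Write it as
    (1 - w)^(- delta) (1 + (u - w) / (1 - u)) with u = w^(1 - delta); both
    factors are bounded by exponentials. *)
Lemma geometric_factor_le w b delta : 0 < w <= b -> b < 1 -> 0 < delta <= 4^-1 ->
  (1 - w) `^ (1 - delta) / (1 - w `^ (1 - delta)) <=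
  expR ((4 * delta * (w * (1 - ln w)) + 2 * expR (- (4 * delta)^-1)) / (1 - b)).
Proof.
move=> /andP[w0 wb] b1 d01; have /andP[d0 d1] := d01.
have w1 : w < 1 by lra.
have w1' : 0 < 1 - w by lra.
have b1' : 0 < 1 - b by lra.
set u := w `^ (1 - delta).
have uw : u <= w `^ 2^-1.
  by rewrite /u !powR_expR_ln// ler_expR ler_wnM2r ?ln_le0 ?(ltW w1)//; lra.
have s0 : 0 <= w `^ 2^-1 by exact: powR_ge0.
have ss : (w `^ 2^-1) ^+ 2 = w.
  by rewrite -powR_mulrn// -powRrM mulVf// powRr1// ltW.
have u1 : (1 - w) / 2 <= 1 - u.
  by have := sqr_ge0 (1 - w `^ 2^-1); move: uw s0 ss; move: (w `^ _) => s; lra.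
have u1' : 0 < 1 - u by apply: lt_le_trans u1; rewrite divr_gt0.
have gap : u - w <= 2 * delta * (w * - ln w) + expR (- (4 * delta)^-1).
  by apply: powR_gap_le; rewrite ?w0.
have wu : 0 <= u - w.
  rewrite subr_ge0 /u powR_expR_ln// -[leLHS](@lnK _ w) ?posrE// ler_expR.
  have : ln w <= 0 by rewrite ln_le0// ltW.
  by nra.
have h1 : (1 - w) `^ (- delta) <= expR (delta * w / (1 - b)).
  rewrite powR_expR_ln// ler_expR mulNr -mulrN -mulrA ler_wpM2l ?(ltW d0)//.
  rewrite -lnV ?posrE//.
  have := @le_ln1Dx R ((1 - w)^-1 - 1).
  have -> : 1 + ((1 - w)^-1 - 1) = (1 - w)^-1 by ring.
  move=> h.
  have wi : 1 < (1 - w)^-1 by rewrite invf_gt1//; lra.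
  apply: le_trans (h _) _; first by lra.
  have -> : (1 - w)^-1 - 1 = w / (1 - w) by field; rewrite gt_eqF.
  by rewrite ler_wpM2l ?(ltW w0)// lef_pV2 ?posrE//; lra.
have h2 : (1 - w) / (1 - u) <= expR (2 * (u - w) / (1 - b)).
  have -> : (1 - w) / (1 - u) = 1 + (u - w) / (1 - u) by field; rewrite gt_eqF.
  apply: le_trans (expR_ge1Dx _) _; rewrite ler_expR.
  rewrite mulrAC mulrC ler_wpM2r// ?[_ / _]mulrC.
  rewrite -[2]invrK -invfM lef_pV2 ?posrE ?mulr_gt0 ?invr_gt0//; lra.
have -> : (1 - w) `^ (1 - delta) = (1 - w) `^ (- delta) * (1 - w).
  by rewrite !powR_expR_ln// addrC mulrDl mul1r expRD lnK.
rewrite -mulrA; apply: le_trans (ler_pM (powR_ge0 _ _) _ h1 h2) _.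
  by rewrite divr_ge0 ?ltW.
rewrite -expRD ler_expR -mulrDl ler_wpM2r ?invr_ge0 ?(ltW b1')//.
by move: gap; move: (expR _) => e; nra.
Qed.

(** With L = - ln w: if L <= 2 D then w - w^(1 + 1/D) = w (1 - exp(- L / D)) is
    at least w L / (3 D); otherwise w L <= 2 exp(- L / 2) is negligible. *)
Lemma entropy_term_le w D : 0 < w < 1 -> 1 <= D ->
  w * - ln w <= 3 * D * (w - w `^ (1 + D^-1)) + 2 * expR (- D).
Proof.
move=> /andP[w0 w1] D1; have D0 : 0 < D by lra.
set L := - ln w; have L0 : 0 < L by rewrite oppr_gt0 ln_lt0// w0.
have wE : w = expR (- L) by rewrite /L opprK lnK.
have -> : w `^ (1 + D^-1) = w * expR (- (L / D)).
  by rewrite powR_expR_ln// mulrDl mul1r expRD lnK ?posrE// /L -mulNr opprK (mulrC D^-1).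
have E0 := expR_ge0 (- D); have [yle|ygt] := leP (L / D) 2.
  have y0 : 0 < L / D by rewrite divr_gt0.
  have h : expR (- (L / D)) <= (1 + L / D)^-1.
    rewrite expRN lef_pV2 ?posrE ?expR_gt0 ?addr_gt0//; exact: expR_ge1Dx.
  have {}h : L / D <= 3 * (1 - expR (- (L / D))).
    apply: le_trans (_ : 3 * (1 - (1 + L / D)^-1) <= _); last by lra.
    have -> : 1 - (1 + L / D)^-1 = (L / D) / (1 + L / D).
      by field; rewrite !gt_eqF// addr_gt0.
    rewrite mulrA ler_pdivlMr; nra.
  have {}h : L <= 3 * D * (1 - expR (- (L / D))).
    by move: h; rewrite ler_pdivrMr// => /le_trans; apply; lra.
  move: h E0; move: (expR (- (L / D))) (expR (- D)) => a b; nra.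
have wp : 0 <= 1 - expR (- (L / D)).
  by rewrite subr_ge0 -[leRHS]expR0 ler_expR oppr_le0 divr_ge0 ?ltW.
apply: (@le_trans _ _ (2 * expR (- D))); last first.
  by rewrite lerDr !mulr_ge0 ?(ltW D0)// -[X in X - _]mulr1 -mulrBr mulr_ge0// ltW.
have -> : w * L = 2 * (L / 2 * expR (- L)) by rewrite -wE; field.
rewrite ler_wpM2l//.
have -> : - L = - (L / 2) + - (L / 2) by field.
rewrite expRD mulrA.
have h : L / 2 * expR (- (L / 2)) <= 1.
  by rewrite expRN ler_pdivrMr ?expR_gt0// mul1r; have := expR_ge1Dx (L / 2); lra.
apply: le_trans (ler_wpM2r (expR_ge0 _) h) _; rewrite mul1r ler_expR lerN2.
by move: ygt; rewrite ltr_pdivlMr//; lra.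
Qed.

End elementary_inequalities.

(** * Concentration of the eigenvalues *)

Section multi_index_sums.
Variables (R : realType) (w : nat -> R) (b : R).
Hypothesis w_gt0 : forall j, 0 < w j.
Hypothesis w_le : forall j, w j <= b.
Hypothesis b_lt1 : b < 1.
Implicit Types (x p D : R) (d m : nat).

Local Notation lam := (tensor_eigenval w).

Let w_lt1 j : w j < 1. Proof. exact: le_lt_trans (w_le j) b_lt1. Qed.

Lemma tensor_eigenval_gt0 d m (a : {ffun 'I_d -> 'I_m}) : 0 < lam a.
Proof.
by apply: prodr_gt0 => j _; rewrite mulr_gt0 ?subr_gt0 ?exprn_gt0.
Qed.

Lemma tensor_eigenval_sum d m :
  \sum_(a : {ffun 'I_d -> 'I_m}) lam a = \prod_(j < d) (1 - w j ^+ m).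
Proof.
rewrite /tensor_eigenval -(bigA_distr_bigA (fun (j : 'I_d) (k : 'I_m) => (1 - w j) * w j ^+ k)).
apply: eq_bigr => j _; rewrite -mulr_sumr -opprB mulNr -subrX1 opprB //.
Qed.

Lemma tensor_eigenval_sum_le1 d m : \sum_(a : {ffun 'I_d -> 'I_m}) lam a <= 1.
Proof.
rewrite tensor_eigenval_sum; apply: prodr_ile1 => j _.
by rewrite subr_ge0 gerBl exprn_ge0 ?exprn_ile1 ?ltW.
Qed.

Lemma tensor_eigenval_sum_cvg1 d x : 0 < x ->
  exists m, 1 - x <= \sum_(a : {ffun 'I_d -> 'I_m}) lam a.
Proof.
move=> x0.
have b0 : 0 < b by apply: lt_le_trans (w_le 0).
have : d%:R * b ^+ m @[m --> \oo] --> d%:R * (0 : R).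
  by apply: cvgMr; apply: cvg_expr; rewrite gtr0_norm.
rewrite mulr0 => /cvgrPdist_le /(_ x x0) [m _ /(_ m (leqnn m))] /=.
rewrite sub0r normrN => h; exists m; rewrite tensor_eigenval_sum.
apply: le_trans (prod_1B_ge _); last first.
  by move=> j; rewrite exprn_ge0 ?exprn_ile1 ?ltW.
rewrite lerD2l lerN2; apply: le_trans (le_trans (ler_norm _) h).
rewrite -[d in leRHS]card_ord mulr_natl -sumr_const; apply: ler_sum => j _.
by rewrite lerXn2r ?nnegrE ?w_le ?(ltW (w_gt0 j)) ?(ltW b0).
Qed.

Lemma tensor_eigenval_powR_sum d m p : 0 < p ->
  \sum_(a : {ffun 'I_d -> 'I_m}) lam a `^ p <=
  \prod_(j < d) ((1 - w j) `^ p / (1 - w j `^ p)).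
Proof.
move=> p0.
have -> : \sum_(a : {ffun 'I_d -> 'I_m}) lam a `^ p =
    \prod_(j < d) \sum_(k < m) (1 - w j) `^ p * (w j `^ p) ^+ k.
  rewrite (bigA_distr_bigA (fun (j : 'I_d) (k : 'I_m) => (1 - w j) `^ p * (w j `^ p) ^+ k)).
  apply: eq_bigr => a _; rewrite /tensor_eigenval powR_prod.
    apply: eq_bigr => j _.
    by rewrite powRM ?subr_ge0 ?exprn_ge0 ?powR_expn_comm ?ltW.
  by move=> j; rewrite mulr_ge0 ?subr_ge0 ?exprn_ge0 ?ltW.
apply: ler_prod => j _; rewrite -mulr_sumr; apply/andP; split.
  by rewrite mulr_ge0 ?powR_ge0// sumr_ge0// => k _; rewrite exprn_ge0 ?powR_ge0.
rewrite ler_wpM2l ?powR_ge0//; apply: geometric_sum_le; rewrite powR_ge0/=.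
rewrite powR_expR_ln// -[ltRHS]expR0 ltr_expR pmulr_rlt0//.
by rewrite ln_lt0// w_gt0 w_lt1.
Qed.

(** Markov's inequality for lam^(-p) under the probability with weights lam. *)
Lemma tensor_eigenval_tail_le d m x p : 0 < x -> 0 <= p ->
  \sum_(a : {ffun 'I_d -> 'I_m} | lam a < x) lam a <=
  x `^ p * \sum_(a : {ffun 'I_d -> 'I_m}) lam a `^ (1 - p).
Proof.
move=> x0 p0; rewrite mulr_sumr big_mkcond/=; apply: ler_sum => a _.
have la := tensor_eigenval_gt0 a.
case: ifP => ax; last by rewrite mulr_ge0 ?powR_ge0.
have {1}-> : lam a = lam a `^ p * lam a `^ (1 - p).
  by rewrite !powR_expR_ln// -expRD -mulrDl addrC subrK mul1r lnK.
by rewrite ler_wpM2r ?powR_ge0// ge0_ler_powR// ?nnegrE ?(ltW la) ?(ltW x0) ?(ltW ax).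
Qed.

(** Keep the multi-indices with lam a >= x. There are at most 1 / x of them, and
    the rest weighs at most x^delta exp((M + 2) / (1 - b)) by Markov's
    inequality with delta = 1 / (4 D); x is chosen to make this
    eps^2 / 2. The other half of eps^2 pays for the truncation to indices
    below m. *)
Lemma few_eigenvalues_suffice d (D M eps : R) : 1 <= D -> d%:R <= expR D ->
  \sum_(j < d) w j * (1 - ln (w j)) <= M * D -> 0 < eps < 1 ->
  exists m (A : {set {ffun 'I_d -> 'I_m}}), [/\ (0 < #|A|)%N,
    #|A|%:R <= expR (4 * D * ((M + 2) / (1 - b) + ln 2 + 2 * ln eps^-1)) &
    1 - \sum_(a in A) lam a <= eps ^+ 2].
Proof.
move=> D1 dD wM /andP[eps0 eps1]; have D0 : 0 < D by lra.
have b1 : 0 < 1 - b by rewrite subr_gt0.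
pose c := (M + 2) / (1 - b); pose y := c + ln 2 + 2 * ln eps^-1.
pose x := expR (- (4 * D * y)); pose delta := (4 * D)^-1.
have d0 : 0 < delta by rewrite invr_gt0 mulr_gt0.
have d1 : delta <= 4^-1 by rewrite lef_pV2 ?posrE ?mulr_gt0//; lra.
have e2 : 0 < eps ^+ 2 / 2 by rewrite divr_gt0 ?exprn_gt0.
have [m hm] := tensor_eigenval_sum_cvg1 d e2.
pose A : {set {ffun 'I_d -> 'I_m}} := [set a | x <= lam a]%SET.
have tail : \sum_(a | a \notin A) lam a <= eps ^+ 2 / 2.
  rewrite (eq_bigl (fun a => lam a < x)) => [|a]; last by rewrite inE -ltNge.
  apply: (le_trans (@tensor_eigenval_tail_le d m x delta (expR_gt0 _) (ltW d0))).
  have p0 : 0 < 1 - delta by lra.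
  apply: (le_trans (ler_wpM2l (powR_ge0 x delta) (tensor_eigenval_powR_sum d m p0))).
  have prodS : \prod_(j < d) ((1 - w j) `^ (1 - delta) / (1 - w j `^ (1 - delta))) <= expR c.
    apply: (@le_trans _ _ (\prod_(j < d) expR ((4 * delta * (w j * (1 - ln (w j))) +
        2 * expR (- (4 * delta)^-1)) / (1 - b)))).
      apply: ler_prod => j _; rewrite geometric_factor_le ?w_gt0 ?w_le ?d0// andbT.
      rewrite divr_ge0 ?powR_ge0// subr_ge0 powR_expR_ln// -[leRHS]expR0 ler_expR.
      by rewrite mulr_ge0_le0 ?ln_le0 ?ltW.
    rewrite -expR_sum ler_expR -mulr_suml ler_wpM2r ?invr_ge0 ?(ltW b1)//.
    rewrite big_split/= -mulr_sumr sumr_const card_ord -[_ *+ d]mulr_natr.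
    have -> : (4 * delta)^-1 = D by rewrite /delta; field; rewrite gt_eqF.
    have h1 : 4 * delta * (\sum_(j < d) w j * (1 - ln (w j))) <= M.
      have -> : 4 * delta = D^-1 by rewrite /delta; field; rewrite gt_eqF.
      by rewrite mulrC ler_pdivrMr.
    have h2 : expR (- D) * d%:R <= 1.
      by rewrite expRN mulrC ler_pdivrMr ?expR_gt0// mul1r.
    by rewrite -mulrA; lra.
  have -> : eps ^+ 2 / 2 = x `^ delta * expR c.
    rewrite powR_expR_ln ?expR_gt0// /x expRK -expRD.
    rewrite -[LHS]lnK ?posrE//; congr expR.
    rewrite lnM ?posrE ?invr_gt0 ?exprn_gt0// lnXn// /y !lnV ?posrE//.
    by rewrite /delta; field; rewrite gt_eqF.
  by rewrite ler_wpM2l ?powR_ge0.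
have err : 1 - \sum_(a in A) lam a <= eps ^+ 2.
  by move: hm; rewrite (bigID (mem A))/= => hm; lra.
exists m, A; split=> //.
- rewrite lt0n; apply: contraTneq err => /eqP; rewrite cards_eq0 => /eqP ->.
  by rewrite big_set0 subr0 -ltNge expr_lt1 ?ltW.
- rewrite -/c -/y -[leRHS]invrK -expRN -/x -[leRHS]mul1r ler_pdivlMr ?expR_gt0//.
  apply: le_trans (tensor_eigenval_sum_le1 d m).
  rewrite [leRHS](bigID (mem A))/= mulr_natl -sumr_const.
  rewrite -[leLHS]addr0 lerD//.
    by apply: ler_sum => a; rewrite inE.
  by rewrite sumr_ge0// => a _; rewrite ltW// tensor_eigenval_gt0.
Qed.

(** If the weights q select at least half of the mass while adding up to n, then
    lam q <= x q + x^(- theta) lam^(1 + theta) with x = 1 / (4 n) leaves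
    1 / 4 <= (4 n)^theta sum_a (lam a)^(1 + theta). For theta = 1 / D the
    factor (4 n)^theta is bounded, and the moment is at most
    exp(- sum_j (w_j - w_j^(1 + theta))). *)
Lemma entropy_le_of_small_dimension d n (D M : R) : 1 <= D -> d%:R <= expR D ->
  (0 < n)%N -> ln (4 * n%:R) <= M * D ->
  (forall m, exists q : {ffun 'I_d -> 'I_m} -> R,
    [/\ forall a, 0 <= q a <= 1, \sum_a q a <= n%:R &
        \sum_a lam a * (1 - q a) <= 4^-1]) ->
  \sum_(j < d) w j * - ln (w j) <= (3 * (ln 4 + M) + 2) * D.
Proof.
move=> D1 dD n0 nM hq; have D0 : 0 < D by lra.
have n0' : 0 < n%:R :> R by rewrite ltr0n.
pose th := D^-1; have th0 : 0 < th by rewrite invr_gt0.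
have [|m hm] := @tensor_eigenval_sum_cvg1 d 4^-1; first by lra.
have [q [q01 qn qe]] := hq m.
pose x := (4 * n%:R)^-1 : R; have x0 : 0 < x by rewrite invr_gt0 mulr_gt0.
have lamq : 2^-1 <= \sum_a lam a * q a.
  move: qe; under eq_bigr do rewrite mulrBr mulr1.
  by rewrite sumrB => qe; lra.
have bound : \sum_a lam a * q a <= x * n%:R + 
    x `^ (- th) * \sum_(a : {ffun 'I_d -> 'I_m}) lam a `^ (1 + th).
  apply: (@le_trans _ _ (\sum_a (x * q a + x `^ (- th) * lam a `^ (1 + th)))); last first.
    by rewrite big_split/= -!mulr_sumr lerD2r ler_wpM2l ?(ltW x0).
  apply: ler_sum => a _; have /andP[q0 q1] := q01 a.
  have la := tensor_eigenval_gt0 a.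
  have [lx|lx] := leP (lam a) x.
    by rewrite -[leLHS]addr0 lerD ?mulr_ge0 ?powR_ge0// ler_wpM2r.
  apply: (@le_trans _ _ (x `^ (- th) * lam a `^ (1 + th))); last first.
    by rewrite lerDr mulr_ge0 ?(ltW x0).
  apply: (@le_trans _ _ (lam a)); first by rewrite ler_piMr// ltW.
  rewrite !powR_expR_ln// -expRD -[leLHS]lnK ?posrE// ler_expR.
  have : ln x <= ln (lam a) by rewrite ler_ln ?posrE// ltW.
  by move: th0; nra.
have xn : x * n%:R = 4^-1 by rewrite /x; field; rewrite gt_eqF.
have prodS : \prod_(j < d) ((1 - w j) `^ (1 + th) / (1 - w j `^ (1 + th))) <=
    expR (- \sum_(j < d) (w j - w j `^ (1 + th))).
  rewrite -sumrN expR_sum; apply: ler_prod => j _.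
  have w0 := w_gt0 j; have w1 := w_lt1 j.
  have wu : w j `^ (1 + th) <= w j.
    rewrite -[leRHS](powRr1 (ltW w0)) !powR_expR_ln// ler_expR.
    by have := ln_lt0 (introT andP (conj w0 w1)); move: th0; nra.
  have u1 : 0 < 1 - w j `^ (1 + th) by lra.
  rewrite divr_ge0 ?powR_ge0 ?(ltW u1)//=.
  apply: (@le_trans _ _ ((1 - w j) / (1 - w j `^ (1 + th)))).
    rewrite ler_wpM2r ?invr_ge0 ?(ltW u1)//.
    have w1' : 0 < 1 - w j by lra.
    rewrite -[leRHS](powRr1 (ltW w1')) !powR_expR_ln// ler_expR.
    have : ln (1 - w j) <= 0 by rewrite ln_le0//; lra.
    by move: th0; nra.
  apply: le_trans (expR_ge1Dx _); rewrite ler_pdivrMr//.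
  by have := powR_ge0 (w j) (1 + th); move: wu u1 w0; move: (_ `^ _) => u; nra.
have th1 : 0 < 1 + th by lra.
have key : 4^-1 <= expR (th * ln (4 * n%:R)) * expR (- \sum_(j < d) (w j - w j `^ (1 + th))).
  have -> : expR (th * ln (4 * n%:R)) = x `^ (- th).
    by rewrite powR_expR_ln// /x lnV ?posrE ?mulr_gt0// mulrNN.
  apply: le_trans (ler_wpM2l (powR_ge0 x (- th))
    (le_trans (tensor_eigenval_powR_sum d m th1) prodS)).
  by move: bound; rewrite xn; lra.
have sumgap : \sum_(j < d) (w j - w j `^ (1 + th)) <= ln 4 + M.
  move: key; rewrite -expRD -[4^-1]lnK ?posrE ?invr_gt0// ler_expR lnV ?posrE//.
  have : th * ln (4 * n%:R) <= M by rewrite mulrC ler_pdivrMr.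
  by lra.
apply: (@le_trans _ _ (\sum_(j < d) (3 * D * (w j - w j `^ (1 + th)) + 2 * expR (- D)))).
  by apply: ler_sum => j _; apply: entropy_term_le; rewrite ?w_gt0 ?w_lt1.
rewrite big_split/= -mulr_sumr sumr_const card_ord -[_ *+ d]mulr_natr.
have h2 : expR (- D) * d%:R <= 1.
  by rewrite expRN mulrC ler_pdivrMr ?expR_gt0// mul1r.
have := ler_wpM2l (ltW D0) sumgap; nra.
Qed.

End multi_index_sums.

(** * The geometric ratio as a function of sigma *)

Section eigenvalue_ratio.
Variable R : realType.
Implicit Types (sigma w x : R).

(** The smaller root of w^2 - 2 t w + 1, where t = 1 + sigma^2 / 2. *)
Lemma eigenvalue_ratio_exists sigma : 0 < sigma ->
  exists w, 0 < w < 1 /\ sigma ^+ 2 * w = (1 - w) ^+ 2.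
Proof.
move=> s0; have x0 : 0 < sigma ^+ 2 by rewrite exprn_gt0.
move: (sigma ^+ 2) x0 => x x0; pose t := 1 + x / 2; pose r := Num.sqrt (t ^+ 2 - 1).
have t1 : 1 < t by rewrite /t; lra.
have r2 : r ^+ 2 = t ^+ 2 - 1 by rewrite sqr_sqrtr// subr_ge0 exprn_ege1// ltW.
have r0 : 0 <= r by rewrite sqrtr_ge0.
have xE : x = 2 * t - 2 by rewrite /t; field.
exists (t - r); split; last first.
  have -> : (1 - (t - r)) ^+ 2 = (2 * t - 2) * (t - r) + (r ^+ 2 - (t ^+ 2 - 1)) by ring.
  by rewrite r2 subrr addr0 xE.
have h1 : r < t by rewrite ltNge; apply/negP => h; nra.
have h2 : t - 1 < r by rewrite ltNge; apply/negP => h; nra.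
by lra.
Qed.

Lemma eigenvalue_ratio_inv sigma w : 0 < w < 1 ->
  sigma ^+ 2 * w = (1 - w) ^+ 2 -> w^-1 = sigma ^+ 2 + 2 - w.
Proof.
move=> /andP[w0 w1] sw; rewrite -[RHS](@mulfK _ w) ?gt_eqF// -[LHS]mul1r.
by congr (_ / _); rewrite mulrBl mulrDl sw; ring.
Qed.

Section bounds.
Variables (sigma w : R).
Hypothesis w01 : 0 < w < 1.
Hypothesis sw : sigma ^+ 2 * w = (1 - w) ^+ 2.
Hypothesis sigma_gt0 : 0 < sigma.

Let x0 : 0 < sigma ^+ 2. Proof. by rewrite exprn_gt0. Qed.
Let w0 : 0 < w. Proof. by case/andP: w01. Qed.

Lemma eigenvalue_ratio_le : w <= (1 + sigma ^+ 2)^-1.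
Proof.
rewrite -[leLHS]invrK lef_pV2 ?posrE ?invr_gt0 ?addr_gt0//.
by rewrite (eigenvalue_ratio_inv w01 sw); move/andP: w01; lra.
Qed.

Lemma eigenvalue_ratio_ln_ge : ln (1 + sigma ^+ 2) <= - ln w.
Proof.
rewrite -lnV ?posrE// ler_ln ?posrE ?invr_gt0 ?addr_gt0//.
by rewrite (eigenvalue_ratio_inv w01 sw); move/andP: w01; lra.
Qed.

Lemma eigenvalue_ratio_ln_le : - ln w <= 1 + ln (1 + sigma ^+ 2).
Proof.
have ln2 : ln 2 <= 1 :> R by have := @le_ln1Dx R 1; rewrite -natr1; apply; lra.
apply: (@le_trans _ _ (ln (2 * (1 + sigma ^+ 2)))); last first.
  by rewrite lnM ?posrE ?addr_gt0// lerD2r.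
rewrite -lnV ?posrE// ler_ln ?posrE ?invr_gt0 ?mulr_gt0 ?addr_gt0//.
by rewrite (eigenvalue_ratio_inv w01 sw); move/andP: w01 x0; lra.
Qed.

Lemma ln1Dsqr_ge0 : 0 <= ln (1 + sigma ^+ 2).
Proof. by rewrite ln_ge0// lerDl ltW. Qed.

Lemma entropy_le_weight :
  w * (1 - ln w) <= 2 * ((1 + ln (1 + sigma ^+ 2)) / sigma ^+ 2).
Proof.
have l0 := ln1Dsqr_ge0.
have wx : w <= (sigma ^+ 2)^-1.
  apply: le_trans eigenvalue_ratio_le _; rewrite lef_pV2 ?posrE ?addr_gt0//; lra.
apply: (@le_trans _ _ ((sigma ^+ 2)^-1 * (2 * (1 + ln (1 + sigma ^+ 2))))); last first.
  by rewrite mulrC mulrA.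
apply: ler_pM => //; first exact: ltW.
  by rewrite -oppr_le0; have := eigenvalue_ratio_ln_ge; lra.
by have := eigenvalue_ratio_ln_le; lra.
Qed.

(** The term 1 of 1 - ln w is absorbed by - ln w, which is at least
    ln (1 + sigma0^2) > 0. *)
Lemma weight_le_entropy sigma0 : 0 < sigma0 -> sigma0 <= sigma ->
  (1 + ln (1 + sigma ^+ 2)) / sigma ^+ 2 <=
  ((1 + 2 / sigma0 ^+ 2) * (1 + (ln (1 + sigma0 ^+ 2))^-1)) * (w * - ln w).
Proof.
move=> s0 ss; have s0x : 0 < sigma0 ^+ 2 by rewrite exprn_gt0.
have sx : sigma0 ^+ 2 <= sigma ^+ 2 by rewrite lerXn2r ?nnegrE ?(ltW s0) ?(ltW sigma_gt0).
have l0 : 0 < ln (1 + sigma0 ^+ 2) by rewrite ln_gt0// ltrDl.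
have L0 : ln (1 + sigma0 ^+ 2) <= - ln w.
  apply: le_trans eigenvalue_ratio_ln_ge.
  by rewrite ler_ln ?posrE ?addr_gt0// lerD2l.
have h1 : 1 + ln (1 + sigma ^+ 2) <= (1 + (ln (1 + sigma0 ^+ 2))^-1) * - ln w.
  rewrite mulrDl mul1r addrC lerD ?eigenvalue_ratio_ln_ge//.
  by rewrite mulrC ler_pdivlMr// mul1r.
have h2 : (sigma ^+ 2)^-1 <= (1 + 2 / sigma0 ^+ 2) * w.
  apply: (@le_trans _ _ ((1 + 2 / sigma0 ^+ 2) * (2 + sigma ^+ 2)^-1)); last first.
    rewrite ler_wpM2l ?addr_ge0 ?divr_ge0 ?(ltW s0x)//.
    rewrite -[leRHS]invrK lef_pV2 ?posrE ?invr_gt0 ?addr_gt0//.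
    by rewrite (eigenvalue_ratio_inv w01 sw); move: w0; lra.
  rewrite ler_pdivlMr ?addr_gt0// mulrC ler_pdivrMr// mulrDl mul1r addrC lerD2l.
  by rewrite mulrAC ler_pdivlMr// ler_wpM2l.
have l1 := ln1Dsqr_ge0; rewrite mulrC.
apply: le_trans (ler_pM _ _ h2 h1) _; rewrite ?invr_ge0 ?(ltW x0)//; first by lra.
by rewrite le_eqVlt; apply/orP; left; apply/eqP; ring.
Qed.

End bounds.
End eigenvalue_ratio.

Section ln_plus_bounds.
Variables (R : realType) (d : nat).
Hypothesis d_gt0 : (0 < d)%N.
Local Notation D := (ln_plus (d%:R : R)).

Lemma ln_nat_ge0 : 0 <= ln (d%:R : R).
Proof. by rewrite ln_ge0// ler1n. Qed.

Lemma ln_plus_ge1 : 1 <= D. Proof. by rewrite le_max lexx. Qed.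

Lemma le_expR_ln_plus : d%:R <= expR D.
Proof.
by rewrite -[leLHS]lnK ?posrE ?ltr0n// ler_expR le_max lexx orbT.
Qed.

Lemma ln_plus_le : D <= 1 + ln (d%:R : R).
Proof. by have := ln_nat_ge0; rewrite ge_max; lra. Qed.

Lemma le_ln_plus : 1 + ln (d%:R : R) <= 2 * D.
Proof.
have := ln_plus_ge1; have : ln (d%:R : R) <= D by rewrite le_max lexx orbT.
lra.
Qed.

End ln_plus_bounds.

Lemma ereal_sup_ltyP (R : realType) (I : Type) (S : set I) (f : I -> R) :
  (ereal_sup [set (f i)%:E | i in S] < +oo)%E <->
  exists M, forall i, S i -> f i <= M.
Proof.
split=> [h|[M hM]].
  move: h; case E : (ereal_sup _) => [M| |]// _.
    exists M => i Si; rewrite -lee_fin -E; apply: ereal_sup_ubound; by exists i.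
  exists 0 => i Si; have : ((f i)%:E <= -oo)%E.
    by rewrite -E; apply: ereal_sup_ubound; exists i.
  by [].
apply: (@le_lt_trans _ _ M%:E); rewrite ?ltry//.
by apply: ub_ereal_sup => _ [i Si <-]; rewrite lee_fin hM.
Qed.

(** * Quasi-polynomial tractability *)

Section qpt_criterion.
Context (R : realType) (sigma : nat -> R) (w : nat -> R) (sigma0 : R).
Hypothesis sigma0_gt0 : 0 < sigma0.
Hypothesis sigma_ge : forall j, sigma0 <= sigma j.
Hypothesis w01 : forall j, 0 < w j < 1.
Hypothesis sigmaw : forall j, sigma j ^+ 2 * w j = (1 - w j) ^+ 2.
Context (d : nat) (disp : measure_display) (Omega : measurableType disp).
Context (P : probability Omega R) (X : Omega -> L2 (std_gaussian R d)).
Hypothesis d_gt0 : (0 < d)%N.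
Hypothesis X_field : sqexp_field sigma P X.
Local Notation D := (ln_plus (d%:R : R)).
Local Notation weight := (\sum_(j < d) (1 + ln (1 + sigma j ^+ 2)) / sigma j ^+ 2).

Let b := (1 + sigma0 ^+ 2)^-1.

Let sigma_gt0 j : 0 < sigma j. Proof. exact: lt_le_trans (sigma_ge j). Qed.

Let w_gt0 j : 0 < w j. Proof. by case/andP: (w01 j). Qed.

Let b_lt1 : b < 1.
Proof. by rewrite /b invf_lt1 ?addr_gt0 ?exprn_gt0// ltrDl exprn_gt0. Qed.

Let w_le j : w j <= b.
Proof.
apply: le_trans (eigenvalue_ratio_le (w01 j) (sigmaw j) (sigma_gt0 j)) _.
rewrite lef_pV2 ?posrE ?addr_gt0 ?exprn_gt0// lerD2l.
by rewrite lerXn2r ?nnegrE ?(ltW sigma0_gt0) ?(ltW (sigma_gt0 j)).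
Qed.

Lemma sqexp_approx_error0 : approx_error P X 0 = 1%E.
Proof.
have mX : measurable_fun setT (fun p => X p.1 p.2) by case: X_field.
exact: (approx_error0 mX (sqexp_field_cov X_field) (@sqexp_kernel_diag R sigma d)).
Qed.

Lemma complexity_le M eps : weight <= M * D -> 0 < eps < 1 ->
  (complexity P X eps <=
   (1 * expR (4 * (`|(2 * M + 2) / (1 - b)| + ln 2 + 2) * (1 + ln eps^-1) *
     (1 + ln d%:R)))%:E)%E.
Proof.
move=> wM eps01; have /andP[eps0 eps1] := eps01.
have entropyM : \sum_(j < d) w j * (1 - ln (w j)) <= 2 * M * D.
  rewrite -mulrA; apply: le_trans (ler_wpM2l _ wM) => //; rewrite mulr_sumr.
  by apply: ler_sum => j _; apply: entropy_le_weight.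
have [m [A [A0 An Ae]]] := few_eigenvalues_suffice w_gt0 w_le b_lt1
  (ln_plus_ge1 R d) (le_expR_ln_plus R d_gt0) entropyM eps01.
apply: (@le_trans _ _ (#|A|%:R%:E)%E).
  apply: ereal_inf_lbound; exists #|A| => //; split=> //.
  rewrite sqexp_approx_error0 mule1.
  apply: le_trans (sqexp_approx_error_le sigma_gt0 w01 sigmaw X_field A) _.
  by rewrite lee_fin -[leRHS](ger0_norm (ltW eps0)) -sqrtr_sqr ler_sqrt ?sqr_ge0.
rewrite lee_fin mul1r; apply: le_trans An _; rewrite ler_expR.
have l0 : 0 <= ln eps^-1 by rewrite ln_ge0// ltW// invf_gt1.
have h1 := ler_norm ((2 * M + 2) / (1 - b)).
have D1 := ln_plus_ge1 R d; have Dle := ln_plus_le R d_gt0.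
have ln20 : 0 <= ln 2 :> R by rewrite ln_ge0// ler1n.
set N := `|_| in h1 *; have N0 : 0 <= N by exact: normr_ge0.
set l := ln eps^-1 in l0 *.
have step : (2 * M + 2) / (1 - b) + ln 2 + 2 * l <= (N + ln 2 + 2) * (1 + l).
  have : 0 <= (N + ln 2) * l by rewrite mulr_ge0// addr_ge0.
  by move: h1; lra.
apply: (@le_trans _ _ (4 * D * ((N + ln 2 + 2) * (1 + l)))).
  by rewrite ler_wpM2l//; lra.
have -> : 4 * D * ((N + ln 2 + 2) * (1 + l)) = 4 * (N + ln 2 + 2) * (1 + l) * D by ring.
by rewrite ler_wpM2l// !mulr_ge0//; lra.
Qed.

Lemma weight_le_of_complexity C K : 0 < C -> 0 <= K ->
  (complexity P X 4^-1 <= (C * expR (K * (1 + ln d%:R)))%:E)%E ->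
  weight <= (1 + 2 / sigma0 ^+ 2) * (1 + (ln (1 + sigma0 ^+ 2))^-1) *
    ((3 * (ln 4 + (ln (4 * (C + 1)) + 2 * K)) + 2) * D).
Proof.
move=> C0 K0 compl.
have [n [n0 err nC]] : exists n : nat, [/\ (0 < n)%N,
    (approx_error P X n < (2^-1)%:E)%E & n%:R <= (C + 1) * expR (K * (1 + ln d%:R))].
  have e1 : 1 <= expR (K * (1 + ln (d%:R : R))).
    rewrite -[leLHS]expR0 ler_expR mulr_ge0// addr_ge0//; exact: ln_nat_ge0.
  have lt1 : (complexity P X 4^-1 < (C * expR (K * (1 + ln d%:R)) + 1)%:E)%E.
    by apply: le_lt_trans compl _; rewrite lte_fin ltrDl.
  have [_ [n [n0 err] <-] ltn] := ereal_inf_lt lt1.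
  exists n; split=> //; last by move: ltn; rewrite lte_fin => /ltW; lra.
  by apply: le_lt_trans err _; rewrite sqexp_approx_error0 mule1 lte_fin; lra.
have n0' : 0 < n%:R :> R by rewrite ltr0n.
have D1 := ln_plus_ge1 R d.
have lnM : ln (4 * n%:R) <= (ln (4 * (C + 1)) + 2 * K) * D.
  have C1 : 0 < 4 * (C + 1) by rewrite mulr_gt0// addr_gt0.
  apply: (@le_trans _ _ (ln (4 * (C + 1) * expR (K * (1 + ln d%:R))))).
    by rewrite ler_ln ?posrE ?mulr_gt0 ?expR_gt0//; lra.
  rewrite lnM ?posrE ?expR_gt0// expRK [leRHS]mulrDl lerD//.
    by rewrite ler_peMr// ln_ge0//; lra.
  rewrite -mulrA mulrCA ler_wpM2l//; exact: le_ln_plus.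
have := entropy_le_of_small_dimension w_gt0 w_le b_lt1 D1 (le_expR_ln_plus R d_gt0) n0 lnM.
have qex m : exists q : {ffun 'I_d -> 'I_m} -> R,
    [/\ forall a, 0 <= q a <= 1, \sum_a q a <= n%:R &
        \sum_a tensor_eigenval w a * (1 - q a) <= 4^-1].
  have half0 : 0 <= 2^-1 :> R by rewrite invr_ge0.
  have [q [q01 qn qe]] := sqexp_approx_error_lower_bound sigma_gt0 w01 sigmaw
    m X_field half0 err.
  by exists q; split=> //; apply: (le_trans qe); lra.
move=> /(_ qex) H; apply: le_trans (ler_wpM2l _ H); last first.
  rewrite mulr_ge0 ?addr_ge0 ?divr_ge0 ?invr_ge0 ?sqr_ge0//.
  by rewrite ln_ge0// lerDl sqr_ge0.
rewrite mulr_sumr; apply: ler_sum => j _.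
exact: weight_le_entropy.
Qed.

End qpt_criterion.

(* sigma j stands for sigma_{j+1}. *)
Theorem theorem4 (R : realType) (sigma : nat -> R)
  (sigma_gt0 : forall j, 0 < sigma j) (sigma_inf : 0 < inf (range sigma))
  (disp : nat -> measure_display)
  (Omega : forall d : nat, measurableType (disp d))
  (P : forall d : nat, probability (Omega d) R)
  (G : forall d : nat, Omega d -> L2 (std_gaussian R d))
  (G_field : forall d : nat, (0 < d)%N -> sqexp_field sigma (P d) (G d)) :
  quasi_polynomially_tractable (fun d eps => complexity (P d) (G d) eps) <->
  (ereal_sup [set ((ln_plus (d%:R : R))^-1 *
                   \sum_(j < d) (1 + ln (1 + sigma j ^+ 2)) / sigma j ^+ 2)%:E
             | d in [set d : nat | (0 < d)%N]] < +oo)%E.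
Proof.
have sigma_ge j : inf (range sigma) <= sigma j.
  apply: ge_inf; last by exists j.
  by exists 0 => _ [i _ <-]; exact: ltW.
have [w /= w_spec] := choice (fun j => eigenvalue_ratio_exists (sigma_gt0 j)).
have w01 j := (w_spec j).1; have sigmaw j := (w_spec j).2.
have ln_plus_gt0 d : 0 < ln_plus (d%:R : R).
  exact: lt_le_trans (ln_plus_ge1 R d).
split=> [[C [s [C0 s0 qpt]]]|/ereal_sup_ltyP[M hM]].
  have K0 : 0 <= s * (1 + ln (4^-1)^-1).
    by rewrite mulr_ge0// addr_ge0// invrK ln_ge0// ler1n.
  apply/ereal_sup_ltyP; eexists => d /= d0.
  rewrite mulrC ler_pdivrMr//.
  have [eps0 eps1] : 0 < 4^-1 :> R /\ 4^-1 < 1 :> R by split; lra.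
  have := weight_le_of_complexity sigma_inf sigma_ge w01 sigmaw d0 (G_field d d0) C0 K0
     (qpt d 4^-1 d0 eps0 eps1).
  by rewrite mulrA; apply.
exists 1, (4 * (`|(2 * M + 2) / (1 - (1 + inf (range sigma) ^+ 2)^-1)| + ln 2 + 2)).
split=> // [|d eps d0 eps0 eps1].
  by rewrite mulr_ge0// !addr_ge0// ln_ge0// ler1n.
apply: (complexity_le sigma_inf sigma_ge w01 sigmaw d0 (G_field d d0)).
  by rewrite -ler_pdivrMr// mulrC; exact: hM.
by rewrite eps0.
Qed.
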